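(* Let $(M,L)$ be an $S_{3}$-like Finsler manifold with $\dim M\geq 4$. If $(M,L)$ admits a concurrent $\pi$-vector field $\overline{\zeta}$, then the $v$-curvature tensor $S$ of the Cartan connection vanishes.
   Context: $M$ is a real paracompact smooth manifold of finite dimension $n$; all objects are $C^\infty$. $\pi:\mathcal{T}M\to M$ is the bundle of nonzero tangent vectors, $\pi^{-1}(TM)\to\mathcal{T}M$ the pullback of $TM$ by $\pi$. Sections of $\pi^{-1}(TM)$ are called $\pi$-vector fields, are written with bars, and form the module $\mathfrak{X}(\pi(M))$. The fundamental $\pi$-vector field is $\overline{\eta}(u)=(u,u)$. $\rho:T(\mathcal{T}M)\to\pi^{-1}(TM)$ is $\rho=(\pi_{\mathcal{T}M},d\pi)$, and $\gamma:\pi^{-1}(TM)\to T(\mathcal{T}M)$ is the vertical lift $\gamma(u,v)=j_u(v)$, with $j_u:T_{\pi(u)}M\to T_u(T_{\pi(u)}M)$ the natural isomorphism. $(M,L)$ is a Finsler manifold with Finsler metric $g$ on $\pi^{-1}(TM)$ (locally $g_{ij}=\frac12\partial^2L^2/\partial y^i\partial y^j$). For a linear connection $D$ on $\pi^{-1}(TM)$ its connection map is $K(X)=D_X\overline{\eta}$; $D$ is regular if $T_u(\mathcal{T}M)=V_u(\mathcal{T}M)\oplus\ker K_u$ for all $u$ ($V$ the vertical bundle), and then its horizontal map is $\beta:=(\rho|_{\ker K})^{-1}$. The torsion is $\mathbf{T}(X,Y)=D_X\rho Y-D_Y\rho X-\rho[X,Y]$, with $Q(\overline{X},\overline{Y})=\mathbf{T}(\beta\overline{X},\beta\overline{Y})$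 and $T(\overline{X},\overline{Y})=\mathbf{T}(\gamma\overline{X},\beta\overline{Y})$. The curvature is $\mathbf{K}(X,Y)\rho Z=-D_XD_Y\rho Z+D_YD_X\rho Z+D_{[X,Y]}\rho Z$, with $v$-curvature $S(\overline{X},\overline{Y})\overline{Z}=\mathbf{K}(\gamma\overline{X},\gamma\overline{Y})\overline{Z}$. The Cartan connection $\nabla$ is the unique regular connection on $\pi^{-1}(TM)$ with $\nabla g=0$, $Q=0$ and $g(T(\overline{X},\overline{Y}),\overline{Z})=g(T(\overline{X},\overline{Z}),\overline{Y})$. Below $\beta,S$ are those of $\nabla$. A $\pi$-vector field $\overline{\zeta}$ is concurrent if $\nabla_{\beta\overline{X}}\overline{\zeta}=-\overline{X}$ and $\nabla_{\gamma\overline{X}}\overline{\zeta}=0$ for all $\overline{X}$. Notation: $\ell(\overline{X}):=L^{-1}g(\overline{X},\overline{\eta})$; $\hbar:=g-\ell\otimes\ell$; $S(\overline{X},\overline{Y},\overline{Z},\overline{W}):=g(S(\overline{X},\overline{Y})\overline{Z},\overline{W})$; $Ric^v(\overline{X},\overline{Y}):=\mathrm{Tr}\{\overline{Z}\mapsto S(\overline{X},\overline{Z})\overline{Y}\}$; $Ric^v_0$ is defined by $g(Ric_0^v(\overline{X}),\overline{Y})=Ric^v(\overline{X},\overline{Y})$; the vertical scalar curvature is $Sc^v:=\mathrm{Tr}\{\overline{X}\mapsto Ric_0^v(\overline{X})\}$. $(M,L)$ is $S_3$-like if $\dim M\geq4$ and $$S(\overline{X},\overline{Y},\overline{Z},\overline{W})=\frac{Sc^{v}}{(n-1)(n-2)}\{\hbar(\overline{X},\overline{Z})\hbar(\overline{Y},\overline{W})-\hbar(\overline{X},\overline{W})\hbar(\overline{Y},\overline{Z})\}.$$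 *)

(* Defs.v *)
From mathcomp Require Import all_boot all_order all_algebra.
From mathcomp Require Import all_classical all_reals all_analysis.

Set Implicit Arguments.
Unset Strict Implicit.
Unset Printing Implicit Defensive.

Import Order.TTheory GRing.Theory Num.Theory.
Import numFieldNormedType.Exports.

Local Open Scope classical_set_scope.
Local Open Scope ring_scope.

Section Smoothness.
Context {R : realType} {V W : normedModType R}.

(* For V finite-dimensional and U open this is the usual class C^k on U: the
   map v |-> 'D_v f x is the Frechet derivative of f at x. *)
Fixpoint class_C (k : nat) (U : set V) (f : V -> W) : Prop :=
  match k with
  | 0 => forall x, U x -> {for x, continuous f}
  | k'.+1 => (forall x, U x -> differentiable f x) /\
             (forall v, class_C k' U ('D_v f))
  end.

Definition smooth_near (x : V) (f : V -> W) : Prop :=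
  exists2 U, open_nbhs x U & forall k, class_C k U f.

End Smoothness.

(* Besides the charts, an atlas selects for every point p a chart [chart_at p]
   around it.  The selection carries no mathematical information: it serves to
   identify the tangent space at p with the model space E, a tangent vector
   being represented by its components in the chart [chart_at p].  So a tangent
   vector at p has type E, its components in any other chart are given by
   [components], and a vector field has type T -> E. *)

Record atlas (R : realType) (E : normedModType R) (T : Type) := Atlas {
  chart_index : Type;
  chart_dom : chart_index -> set T;
  chart_map : chart_index -> T -> E;
  chart_at : T -> chart_index
}.

Section Atlas.
Context {R : realType} {E : normedModType R} {T : choiceType}.
Variable A : atlas E T.

(* The inverse of the chart e on its image; it takes the value p elsewhere. *)
Definition chart_inv (e : chart_index A) (p : T) : E -> T :=
  fun x => xget p [set q | chart_dom e q /\ chart_map e q = x].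

Definition coord_at (p : T) : E := chart_map (chart_at A p) p.

Definition in_chart_at {W : Type} (p : T) (f : T -> W) : E -> W :=
  f \o chart_inv (chart_at A p) p.

Definition smooth_at {W : normedModType R} (p : T) (f : T -> W) : Prop :=
  smooth_near (coord_at p) (in_chart_at p f).

Definition smooth {W : normedModType R} (f : T -> W) : Prop :=
  forall p, smooth_at p f.

(* v is a tangent vector at p, read in the chart selected at p. *)
Definition tderive {W : normedModType R} (f : T -> W) (p : T) (v : E) : W :=
  'D_v (in_chart_at p f) (coord_at p).

(* The components in the chart e of the tangent vector v at p. *)
Definition components (e : chart_index A) (p : T) (v : E) : E :=
  tderive (chart_map e) p v.

Definition smooth_vfield (X : T -> E) : Prop :=
  forall p, smooth_at p (fun q => components (chart_at A p) q (X q)).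

(* [X, Y]^i = X (Y^i) - Y (X^i) at p, in the chart selected at p. *)
Definition lie_bracket (X Y : T -> E) : T -> E := fun p =>
  tderive (fun q => components (chart_at A p) q (Y q)) p (X p)
  - tderive (fun q => components (chart_at A p) q (X q)) p (Y p).

End Atlas.

(* The differential at p, read in the charts selected at p and at f p. *)
Definition tangent_map {R : realType} {E E' : normedModType R}
    {T T' : choiceType} (A : atlas E T) (A' : atlas E' T') (f : T -> T')
    (p : T) (v : E) : E' :=
  tderive A (chart_map (chart_at A' (f p)) \o f) p v.

Definition open_cover {T : topologicalType} (C : set (set T)) : Prop :=
  C `<=` open /\ \bigcup_(U in C) U = setT.

Definition locally_finite {T : topologicalType} (C : set (set T)) : Prop :=
  forall p : T, exists2 N, nbhs p N &
    finite_set [set U | C U /\ U `&` N !=set0].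

Definition refines {T : Type} (C' C : set (set T)) : Prop :=
  forall U', C' U' -> exists2 U, C U & U' `<=` U.

Definition paracompact (T : topologicalType) : Prop :=
  forall C : set (set T), open_cover C ->
  exists C' : set (set T), [/\ open_cover C', refines C' C & locally_finite C'].

Record is_smooth_manifold {R : realType} {E : normedModType R}
    {M : topologicalType} (A : atlas E M) : Prop := IsSmoothManifold {
  manifold_hausdorff : hausdorff_space M;
  manifold_paracompact : paracompact M;
  chart_at_dom : forall p, chart_dom (chart_at A p) p;
  chart_dom_open : forall e : chart_index A, open (chart_dom e);
  chart_inj : forall (e : chart_index A) p q,
    chart_dom e p -> chart_dom e q -> chart_map e p = chart_map e q -> p = q;
  chart_continuous : forall (e : chart_index A) p,
    chart_dom e p -> {for p, continuous (chart_map e)};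
  chart_open : forall (e : chart_index A) (U : set M),
    open U -> U `<=` chart_dom e -> open (chart_map e @` U);
  chart_transition : forall (e e' : chart_index A) p,
    chart_dom e p -> chart_dom e' p ->
    smooth_near (chart_map e p) (chart_map e' \o chart_inv e p)
}.

Section Finsler.
Context {R : realType} {n : nat} {M : topologicalType}.

Local Notation Rn := 'rV[R]_n.

(* The tangent bundle TM is represented by M * 'rV[R]_n. *)
Definition slit : choiceType := {u : M * Rn | u.2 != 0}.

Definition slit_proj (u : slit) : M := (val u).1.

Variable A : atlas Rn M.

(* The chart (x, y) of the bundle of nonzero tangent vectors induced by a chart
   x of M. *)
Definition slit_atlas : atlas (Rn * Rn)%type slit := {|
  chart_index := chart_index A;
  chart_dom := fun e => slit_proj @^-1` chart_dom e;
  chart_map := fun e u =>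
    (chart_map e (slit_proj u), components e (slit_proj u) (val u).2);
  chart_at := fun u => chart_at A (slit_proj u) |}.

Local Notation vfield := (slit -> (Rn * Rn)%type).

(* A pi-vector field: its value at u is a tangent vector of M at the base point
   of u. *)
Local Notation pi_vfield := (slit -> Rn).

Definition smooth_pi_vfield (zeta : pi_vfield) : Prop :=
  forall u, smooth_at slit_atlas u
    (fun w => components (chart_at A (slit_proj u)) (slit_proj w) (zeta w)).

Definition eta : pi_vfield := fun u => (val u).2.

Definition rho_at (u : slit) (x : Rn * Rn) : Rn :=
  tangent_map slit_atlas A slit_proj u x.

(* The derivative at eta u, along v, of the inclusion of the fibre through u;
   [insubd] only discards the zero vector, which is away from eta u. *)
Definition gamma_at (u : slit) (v : Rn) : Rn * Rn :=
  'D_v (fun y : Rn => chart_map (chart_at slit_atlas u)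
                        (insubd u (slit_proj u, y))) (eta u).

Definition rho (X : vfield) : pi_vfield := fun u => rho_at u (X u).

Definition gamma (X : pi_vfield) : vfield := fun u => gamma_at u (X u).

Definition vertical (u : slit) : set (Rn * Rn) := [set x | rho_at u x = 0].

Record is_connection (D : vfield -> pi_vfield -> pi_vfield) : Prop :=
  IsConnection {
  conn_smooth : forall X Z, smooth_vfield slit_atlas X -> smooth_pi_vfield Z ->
    smooth_pi_vfield (D X Z);
  conn_addl : forall X Y Z, smooth_vfield slit_atlas X ->
    smooth_vfield slit_atlas Y -> smooth_pi_vfield Z ->
    forall u, D (fun w => X w + Y w) Z u = D X Z u + D Y Z u;
  conn_scalel : forall (f : slit -> R) X Z, smooth slit_atlas f ->
    smooth_vfield slit_atlas X -> smooth_pi_vfield Z ->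
    forall u, D (fun w => f w *: X w) Z u = f u *: D X Z u;
  conn_addr : forall X Y Z, smooth_vfield slit_atlas X ->
    smooth_pi_vfield Y -> smooth_pi_vfield Z ->
    forall u, D X (fun w => Y w + Z w) u = D X Y u + D X Z u;
  conn_leibniz : forall (f : slit -> R) X Z, smooth slit_atlas f ->
    smooth_vfield slit_atlas X -> smooth_pi_vfield Z ->
    forall u, D X (fun w => f w *: Z w) u
              = tderive slit_atlas f u (X u) *: Z u + f u *: D X Z u
}.

Section Connection.
Variable D : vfield -> pi_vfield -> pi_vfield.

Definition connection_map (X : vfield) : pi_vfield := D X eta.

(* [connection_map] is tensorial, so its kernel at u is the set of the values at
   u of the vector fields X for which connection_map X vanishes at u. *)
Definition connection_ker (u : slit) : set (Rn * Rn) :=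
  [set x | exists X, [/\ smooth_vfield slit_atlas X, X u = x
                       & connection_map X u = 0]].

Definition regular : Prop := forall (u : slit) (x : Rn * Rn),
  exists! vh : (Rn * Rn) * (Rn * Rn),
    [/\ vertical u vh.1, connection_ker u vh.2 & x = vh.1 + vh.2].

(* beta = (rho restricted to ker K)^-1; meaningful if D is regular. *)
Definition beta (X : pi_vfield) : vfield := fun u =>
  xget 0 [set h | connection_ker u h /\ rho_at u h = X u].

Definition torsion (X Y : vfield) : pi_vfield := fun u =>
  D X (rho Y) u - D Y (rho X) u - rho (lie_bracket slit_atlas X Y) u.

Definition Q_torsion (X Y : pi_vfield) : pi_vfield := torsion (beta X) (beta Y).

Definition T_torsion (X Y : pi_vfield) : pi_vfield :=
  torsion (gamma X) (beta Y).

Definition curvature (X Y : vfield) (Z : pi_vfield) : pi_vfield := fun u =>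
  - D X (D Y Z) u + D Y (D X Z) u + D (lie_bracket slit_atlas X Y) Z u.

Definition v_curvature (X Y Z : pi_vfield) : pi_vfield :=
  curvature (gamma X) (gamma Y) Z.

Definition is_concurrent (zeta : pi_vfield) : Prop :=
  smooth_pi_vfield zeta /\
  forall X, smooth_pi_vfield X -> forall u,
    D (beta X) zeta u = - X u /\ D (gamma X) zeta u = 0.

End Connection.

Variable L : M * Rn -> R.

(* g_ij = 1/2 d^2 L^2 / dy^i dy^j: the second derivative of L^2 / 2 along the
   fibre, which is a vector space. *)
Definition finsler_metric (u : slit) (v w : Rn) : R :=
  2^-1 * 'D_v ('D_w (fun y : Rn => L (slit_proj u, y) ^+ 2)) (eta u).

Record is_finsler : Prop := IsFinsler {
  finsler_smooth : smooth slit_atlas (fun u => L (val u));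
  finsler0 : forall p, L (p, 0) = 0;
  finsler_gt0 : forall p v, v != 0 -> 0 < L (p, v);
  finsler_homog : forall p v (a : R), 0 < a -> L (p, a *: v) = a * L (p, v);
  finsler_posdef : forall u v, v != 0 -> 0 < finsler_metric u v v
}.

Local Notation g := finsler_metric.

Definition ell (u : slit) (v : Rn) : R := (L (val u))^-1 * g u v (eta u).

Definition hbar (u : slit) (v w : Rn) : R := g u v w - ell u v * ell u w.

Record is_cartan_connection (D : vfield -> pi_vfield -> pi_vfield) : Prop :=
  IsCartan {
  cartan_connection : is_connection D;
  cartan_regular : regular D;
  cartan_metric : forall X Y Z, smooth_vfield slit_atlas X ->
    smooth_pi_vfield Y -> smooth_pi_vfield Z ->
    forall u, tderive slit_atlas (fun w => g w (Y w) (Z w)) u (X u)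
              = g u (D X Y u) (Z u) + g u (Y u) (D X Z u);
  cartan_Q : forall X Y, smooth_pi_vfield X -> smooth_pi_vfield Y ->
    forall u, Q_torsion D X Y u = 0;
  cartan_T : forall X Y Z, smooth_pi_vfield X -> smooth_pi_vfield Y ->
    smooth_pi_vfield Z ->
    forall u, g u (T_torsion D X Y u) (Z u) = g u (T_torsion D X Z u) (Y u)
}.

Definition pi_vfield_through (u : slit) (v : Rn) : pi_vfield :=
  xget (fun=> 0) [set Z | smooth_pi_vfield Z /\ Z u = v].

(* For F linear over the smooth functions, F Z u depends only on Z u, so that
   the choice of the field through v is immaterial. *)
Definition pi_trace (F : pi_vfield -> pi_vfield) (u : slit) : R :=
  \tr (lin1_mx (fun v : Rn => F (pi_vfield_through u v) u)).

Section Curvatures.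
Variable D : vfield -> pi_vfield -> pi_vfield.

Definition v_ricci (X Y : pi_vfield) (u : slit) : R :=
  pi_trace (fun Z => v_curvature D X Z Y) u.

Definition v_ricci0 (X : pi_vfield) : pi_vfield := fun u =>
  xget 0 [set w | forall Y, smooth_pi_vfield Y -> g u w (Y u) = v_ricci X Y u].

Definition v_scalar (u : slit) : R := pi_trace v_ricci0 u.

Definition is_S3_like : Prop := (4 <= n)%N /\
  forall X Y Z W, smooth_pi_vfield X -> smooth_pi_vfield Y ->
    smooth_pi_vfield Z -> smooth_pi_vfield W ->
  forall u, g u (v_curvature D X Y Z u) (W u) =
    v_scalar u / ((n%:R - 1) * (n%:R - 2)) *
    (hbar u (X u) (Z u) * hbar u (Y u) (W u)
     - hbar u (X u) (W u) * hbar u (Y u) (Z u)).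

End Curvatures.

End Finsler.

Arguments slit R n M : clear implicits.

(* Main.v *)
From HB Require Import structures.
Require Import Defs.
From mathcomp Require Import all_boot all_order all_algebra.
From mathcomp Require Import all_classical all_reals all_analysis.
Import Order.TTheory GRing.Theory Num.Theory.
Import numFieldNormedType.Exports.
Local Open Scope classical_set_scope.
Local Open Scope ring_scope.

(** Write S for the v-curvature, g for the Finsler metric and eta for the
    fundamental field.

    Commutation of vertical derivatives.  A concurrent field zeta satisfies
    nabla_(gamma X) zeta = 0 for every X, and the bracket of two vertical
    fields is again a vertical field gamma W, so S(X, Y) zeta = 0
    ([concurrent_v_curvature]).

    Linear algebra at one point.  If S does not vanish at u then Sc^v does not
    vanish at u, and the S3-like formula with zeta in the third slot says that
    hbar(X, zeta) hbar(Y, W) = hbar(X, W) hbar(Y, zeta).  If hbar(., zeta) were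
    nonzero, hbar would have rank one; but hbar agrees with the positive
    definite g on the kernel of ell, whose dimension is at least three.  Hence
    hbar(., zeta) = 0, that is, zeta is a multiple of eta at u
    ([angular_degenerate], [concurrent_parallel_eta]).

    A single direction can be parallel to zeta, so the contradiction has to come
    from a neighbourhood.  By continuity S is nonzero near u, so zeta = f eta
    there.  Let y be nonzero and orthogonal to eta at u, let X satisfy
    nabla_(gamma X) eta = y at u, and let Y be a field with value y at u.
    Differentiating g(Y, zeta) = f g(Y, eta) along gamma X by metricity gives
    f(u) g(y, y) = 0.  So zeta vanishes at every point where S does not
    ([concurrent_vanishes]).  Then zeta vanishes near u, and differentiating
    g(eta, zeta) = 0 along beta eta gives g(eta, eta) = 0 at u, which is absurd
    ([concurrent_not_near0]).

    Global fields with prescribed values at a point are provided by regularity,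
    since the horizontal part of a tangent vector is by definition a value of a
    smooth field.  Locality of the connection is replaced by metricity, which turns
    statements about nabla into statements about derivatives of functions.  The
    fields gamma X, [gamma X, gamma Y] = gamma W and beta X have to be known to
    be smooth before the axioms of a connection apply to them; this is what most
    of the calculus below is for ([fibre_bracket_smooth], [beta_smooth]). *)

Set Implicit Arguments.
Unset Strict Implicit.
Unset Printing Implicit Defensive.

(** * Directional derivatives *)

Lemma linear_fZ {R : pzRingType} {W W' : lmodType R} {f : W -> W'} (lf : linear f) a v :
  f (a *: v) = a *: f v.
Proof.
have f0 : f 0 = 0 by have := lf (-1) 0 0; rewrite scaler0 addr0 scaleN1r addNr.
by have := lf a v 0; rewrite f0 !addr0.
Qed.

Section DirectionalDerivatives.
Context {R : realType} {V W : normedModType R}.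

(** The difference of the two functions is eventually zero, hence negligible, so
    the differential of one is a differential of the other. *)
Lemma differentiable_near_eq {f g : V -> W} {x : V} :
  (\near x, f x = g x) -> differentiable f x -> differentiable g x.
Proof.
move=> fg df.
have fgx : f x = g x := nbhs_singleton fg.
have E : g \o shift x = cst (g x) + 'd f x +o_ 0 id.
  apply/eqaddoP => e e0.
  have /eqaddoP /(_ e e0) := diff_locally df.
  apply: filter_app.
  have := fg; rewrite (near_shift 0 x) subr0 => fg'.
  near=> h => /=.
  suff -> : (f \o shift x - (cst (f x) + 'd f x)) h =
            (g \o shift x - (cst (g x) + 'd f x)) h by [].
  rewrite -fgx; rewrite -![(_ - _ : _ -> _) _]/(_ - _) /=; congr (_ - _).
  by have := near fg' h; apply.
apply/diff_locallyP.
by rewrite (diff_unique (diff_continuous df) E); split => //; exact: diff_continuous.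
Unshelve. all: by end_near. Qed.

Lemma derive_comp {U : normedModType R} {f : U -> V} {g : V -> W} {x : U} (v : U) :
  differentiable f x -> differentiable g (f x) ->
  'D_v (g \o f) x = 'D_('D_v f x) g (f x).
Proof.
move=> df dg.
by rewrite (deriveE _ (differentiable_comp df dg)) (deriveE _ df) (deriveE _ dg) diff_comp.
Qed.

Lemma derive_lin (l : {linear V -> W}) (x v : V) :
  continuous l -> 'D_v l x = l v.
Proof. by move=> lc; rewrite deriveE ?diff_lin //; exact: linear_differentiable. Qed.

Lemma deriveDir {f : V -> W} {x : V} (a : R) (v w : V) : differentiable f x ->
  'D_(a *: v + w) f x = a *: 'D_v f x + 'D_w f x.
Proof. by move=> df; rewrite !deriveE // linearP. Qed.

(** Uncurried scaling, so that the product rule for a variable scalar and a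
    variable vector is the chain rule for a continuous bilinear map. *)
Definition scaler_pair (p : R * W) : W := p.1 *: p.2.

Lemma diff_scaler_pair (p q : R * W) :
  differentiable scaler_pair p /\ 'd scaler_pair p q = p.1 *: q.2 + q.1 *: p.2.
Proof.
have bl : bilinear_for (GRing.Scale.Law.clone _ _ *:%R _)
    (GRing.Scale.Law.clone _ _ *:%R _) (@GRing.scale R W).
  split=> [u'|u] a x y /=; first by rewrite scalerDl scalerA.
  by rewrite scalerDr !scalerA mulrC.
pose bM := bilinear_isBilinear.Build R R W W _ _ (@GRing.scale R W) bl.
pose b : {bilinear R -> W -> W} := HB.pack (@GRing.scale R W) bM.
have bc : continuous (fun p : R * W => b p.1 p.2) by move=> r; exact: scale_continuous.
split; first exact: (differentiable_bilin (f := b) p bc).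
by have /(congr1 (fun F => F q)) := diff_bilin (f := b) p bc.
Qed.

Lemma differentiable_scale {k : V -> R} {f : V -> W} {x : V} :
  differentiable k x -> differentiable f x ->
  differentiable (fun y => k y *: f y) x.
Proof.
move=> dk df.
apply: (@differentiable_comp _ _ _ _ (fun y => (k y, f y)) scaler_pair).
  exact: differentiable_pair.
by have [] := diff_scaler_pair (k x, f x) (k x, f x).
Qed.

Lemma derive_scale {k : V -> R} {f : V -> W} {x : V} (v : V) :
  differentiable k x -> differentiable f x ->
  'D_v (fun y => k y *: f y) x = k x *: 'D_v f x + 'D_v k x *: f x.
Proof.
move=> dk df; rewrite !deriveE //; last exact: differentiable_scale.
have dp := differentiable_pair dk df.
rewrite (_ : (fun y => _) = scaler_pair \o (fun y => (k y, f y))) //.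
rewrite diff_comp //=; last by have [] := diff_scaler_pair (k x, f x) (k x, f x).
have [_ ->] := diff_scaler_pair (k x, f x) ('d (fun y => (k y, f y)) x v).
by rewrite diff_pair.
Qed.

End DirectionalDerivatives.

(** * Maps of class C^k and smooth germs *)

Section ClassC.
Context {R : realType} {V : normedModType R}.
Implicit Types (U : set V) (k : nat).

Lemma class_C_sub {W : normedModType R} {k} {U U' : set V} {f : V -> W} :
  U' `<=` U -> class_C k U f -> class_C k U' f.
Proof.
move=> sUU'; elim: k f => [|k IH] f /=; first by move=> fc x /sUU' /fc.
by move=> [df Df]; split=> [x /sUU' /df //|v]; exact: IH.
Qed.

(** Openness of U matters: the derivatives occurring in the definition of class
    C^k only depend on germs at the points of U. *)
Lemma class_C_eq {W : normedModType R} {k} {U : set V} {f g : V -> W} :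
  open U -> (forall x, U x -> f x = g x) -> class_C k U f -> class_C k U g.
Proof.
move=> oU; elim: k f g => [|k IH] f g fg /=.
  move=> fc x Ux; suff : g @ x --> f x by rewrite (fg x Ux).
  apply: cvg_trans (fc x Ux); apply: near_eq_cvg.
  by apply: filterS (open_nbhs_nbhs (conj oU Ux)).
move=> [df Df]; split=> [x Ux|v].
  apply: differentiable_near_eq (df x Ux).
  by apply: filterS (open_nbhs_nbhs (conj oU Ux)).
apply: IH (Df v) => x Ux; apply: near_eq_derive.
by apply: filterS (open_nbhs_nbhs (conj oU Ux)).
Qed.

Lemma class_CS {W : normedModType R} {k} {U : set V} {f : V -> W} :
  class_C k.+1 U f -> class_C k U f.
Proof.
elim: k f => [|k IH] f [df Df]; first by move=> x /df /differentiable_continuous.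
by split=> // v; exact: IH.
Qed.

Lemma class_C_cst {W : normedModType R} {k} {U : set V} (a : W) :
  class_C k U (fun=> a).
Proof.
elim: k a => [|k IH] a /=; first by move=> x _; exact: cst_continuous.
split=> [x _|v]; first exact: differentiable_cst.
by rewrite (_ : 'D_v _ = fun=> 0) //; apply/funext => x; rewrite derive_cst.
Qed.

Lemma class_C_add {W : normedModType R} {k} {U : set V} {f g : V -> W} :
  open U -> class_C k U f -> class_C k U g -> class_C k U (fun x => f x + g x).
Proof.
move=> oU; elim: k f g => [|k IH] f g /=.
  by move=> fc gc x Ux; exact: continuousD (fc x Ux) (gc x Ux).
move=> [df Df] [dg Dg]; split=> [x Ux|v].
  exact: differentiableD (df x Ux) (dg x Ux).
apply: class_C_eq oU _ (IH _ _ (Df v) (Dg v)) => x Ux.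
by rewrite -deriveD //; apply: diff_derivable; [exact: df|exact: dg].
Qed.

Lemma class_C_linear {W W' : normedModType R} {k} {U : set V} {f : V -> W}
    (l : {linear W -> W'}) :
  continuous l -> open U -> class_C k U f -> class_C k U (l \o f).
Proof.
move=> lc oU; elim: k f => [|k IH] f /=.
  move=> fc x Ux; exact: continuous_comp (fc x Ux) (lc _).
move=> [df Df]; split=> [x Ux|v].
  exact: differentiable_comp (df x Ux) (linear_differentiable _ _).
apply: class_C_eq oU _ (IH _ (Df v)) => x Ux /=.
rewrite derive_comp ?derive_lin //; first exact: df.
exact: linear_differentiable.
Qed.

Lemma class_C_lin {W : normedModType R} {k} {U : set V} (l : {linear V -> W}) :
  continuous l -> class_C k U l.
Proof.
move=> lc; case: k => [|k] /=; first by move=> x _; exact: lc.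
split=> [x _|v]; first exact: linear_differentiable.
by rewrite (_ : 'D_v _ = fun=> l v); [exact: class_C_cst|apply/funext => x; rewrite derive_lin].
Qed.

Lemma class_C_scale {W : normedModType R} {k} {U : set V} {c : V -> R}
    {f : V -> W} : open U -> class_C k U c -> class_C k U f ->
  class_C k U (fun x => c x *: f x).
Proof.
move=> oU; elim: k c f => [|k IH] c f /=.
  by move=> cc fc x Ux; exact: cvgZ (cc x Ux) (fc x Ux).
move=> C1 F1; have [[dc Dc] [df Df]] := (C1, F1).
have [Ck Fk] := (class_CS C1, class_CS F1).
split=> [x Ux|v]; first exact: differentiable_scale (dc x Ux) (df x Ux).
have := class_C_add oU (IH _ _ Ck (Df v)) (IH _ _ (Dc v) Fk).
apply: (class_C_eq oU) => x Ux.
by rewrite (derive_scale _ (dc x Ux) (df x Ux)).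
Qed.

Lemma class_C_inv {k} {U : set V} {f : V -> R} :
  open U -> (forall x, U x -> f x != 0) -> class_C k U f ->
  class_C k U (fun x => (f x)^-1).
Proof.
move=> oU f0; elim: k => [|k IH] /=.
  by move=> fc x Ux; exact: cvgV (f0 x Ux) (fc x Ux).
move=> [df Df]; have Fk := class_CS (conj df Df).
split=> [x Ux|v]; first exact: differentiableV (df x Ux) (f0 x Ux).
have F2 := class_C_scale (W := R) oU (IH Fk) (IH Fk).
have := class_C_scale (W := R) oU (class_C_cst (W := R) (-1 : R)) (class_C_scale (W := R) oU F2 (Df v)).
apply: (class_C_eq oU) => x Ux.
rewrite (deriveV (f0 x Ux)); last exact/diff_derivable/df.
rewrite scaleN1r scaleNr expr2 invfM //.
Qed.

End ClassC.

Section SmoothNear.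
Context {R : realType} {V : normedModType R}.

Lemma smooth_near_eq {W : normedModType R} {x : V} {f g : V -> W} :
  (\near x, f x = g x) -> smooth_near x f -> smooth_near x g.
Proof.
rewrite -nbhs_nearE nbhsE => -[B oB Bfg] [U oU fU]; exists (U `&` B); first exact: open_nbhsI.
move=> k; apply: (class_C_eq (f := f)) (class_C_sub _ (fU k)).
- by apply: openI; [case: oU|case: oB].
- by move=> y [_ /Bfg].
- by move=> y [].
Qed.

Lemma smooth_near_near {W : normedModType R} {x : V} {f : V -> W} :
  smooth_near x f -> \near x, smooth_near x f.
Proof.
by case=> U [oU Ux] fU; apply: filterS (open_nbhs_nbhs (conj oU Ux)) => y Uy; exists U.
Qed.

Lemma smooth_near_differentiable {W : normedModType R} {x : V} {f : V -> W} :
  smooth_near x f -> differentiable f x.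
Proof. by case=> U [oU Ux] /(_ 1%N) [df _]; exact: df. Qed.

Lemma smooth_near_derive {W : normedModType R} {x : V} {f : V -> W} (v : V) :
  smooth_near x f -> smooth_near x ('D_v f).
Proof. by case=> U oU fU; exists U => // k; have [_] := fU k.+1; apply. Qed.

Lemma smooth_near_cst {W : normedModType R} {x : V} (a : W) :
  smooth_near x (fun=> a).
Proof. by exists setT; [split=> //; exact: openT|move=> k; exact: class_C_cst]. Qed.

Lemma smooth_near_lin {W : normedModType R} {x : V} (l : {linear V -> W}) :
  continuous l -> smooth_near x l.
Proof. by move=> lc; exists setT; [split=> //; exact: openT|move=> k; exact: class_C_lin]. Qed.

Lemma smooth_near_linear {W W' : normedModType R} {x : V} {f : V -> W}
    (l : {linear W -> W'}) :
  continuous l -> smooth_near x f -> smooth_near x (l \o f).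
Proof.
move=> lc [U oU fU]; exists U => // k; apply: class_C_linear => //; by case: oU.
Qed.

Lemma smooth_near2 {W1 W2 W3 : normedModType R} {x : V} {f : V -> W1}
    {g : V -> W2} {h : V -> W3} :
  (forall k (U : set V), open U -> class_C k U f -> class_C k U g -> class_C k U h) ->
  smooth_near x f -> smooth_near x g -> smooth_near x h.
Proof.
move=> fgh [U oU fU] [U' oU' gU]; exists (U `&` U'); first exact: open_nbhsI.
move=> k; apply: fgh.
- by apply: openI; [case: oU|case: oU'].
- by apply: class_C_sub (fU k) => y [].
- by apply: class_C_sub (gU k) => y [].
Qed.

Lemma smooth_near_add {W : normedModType R} {x : V} {f g : V -> W} :
  smooth_near x f -> smooth_near x g -> smooth_near x (fun y => f y + g y).
Proof. by apply: smooth_near2 => k U; exact: class_C_add. Qed.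

Lemma smooth_near_scale {W : normedModType R} {x : V} {c : V -> R} {f : V -> W} :
  smooth_near x c -> smooth_near x f -> smooth_near x (fun y => c y *: f y).
Proof. by apply: smooth_near2 => k U; exact: class_C_scale. Qed.

Lemma smooth_near_mul {x : V} {c f : V -> R} :
  smooth_near x c -> smooth_near x f -> smooth_near x (fun y => c y * f y).
Proof. exact: (smooth_near_scale (W := R)). Qed.

Lemma smooth_near_inv {x : V} {f : V -> R} :
  f x != 0 -> smooth_near x f -> smooth_near x (fun y => (f y)^-1).
Proof.
move=> fx0 sf.
have : \near x, f x != 0.
  have fc := differentiable_continuous (smooth_near_differentiable sf).
  exact: (cvgr_neq0 _ fc fx0).
rewrite -nbhs_nearE nbhsE => -[B oB Bf0]; case: sf => U oU fU.
exists (U `&` B); first exact: open_nbhsI.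
move=> k; apply: class_C_inv.
- by apply: openI; [case: oU|case: oB].
- by move=> y [_ /Bf0].
- by apply: class_C_sub (fU k) => y [].
Qed.

Lemma smooth_near_sum {W : normedModType R} {x : V} {I : Type} (r : seq I)
    (P : pred I) (f : I -> V -> W) :
  (forall i, P i -> smooth_near x (f i)) ->
  smooth_near x (fun y => \sum_(i <- r | P i) f i y).
Proof.
move=> fs; elim: r => [|i r IH].
  by under eq_fun do rewrite big_nil; exact: smooth_near_cst.
under eq_fun do rewrite big_cons.
by case Pi: (P i) => //; exact: smooth_near_add (fs i Pi) IH.
Qed.

Lemma smooth_near_prod {x : V} {I : Type} (r : seq I)
    (P : pred I) (f : I -> V -> R) :
  (forall i, P i -> smooth_near x (f i)) ->
  smooth_near x (fun y => \prod_(i <- r | P i) f i y).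
Proof.
move=> fs; elim: r => [|i r IH].
  rewrite (_ : (fun y => _) = fun=> 1); first exact: smooth_near_cst.
  by apply/funext => y; rewrite big_nil.
rewrite (_ : (fun y => _) = fun y => if P i then f i y * \prod_(j <- r | P j) f j y
                                     else \prod_(j <- r | P j) f j y); last first.
  by apply/funext => y; rewrite big_cons.
by case Pi: (P i) => //; exact: smooth_near_mul (fs i Pi) IH.
Qed.

Definition linear_of {W W' : lmodType R} (f : W -> W') (lf : linear f) :
  {linear W -> W'} := HB.pack f (GRing.isLinear.Build _ _ _ _ f lf).

Lemma smooth_near_coord {m n : nat} {x : V} {f : V -> 'M[R]_(m, n)} i j :
  smooth_near x f -> smooth_near x (fun y => f y i j).
Proof.
move=> fs.
have lc : linear (fun A : 'M[R]_(m, n) => A i j : R) by move=> a A B; rewrite !mxE.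
by apply: (smooth_near_linear (l := linear_of lc)) fs => A; exact: coord_continuous.
Qed.

Lemma smooth_near_fst {W W' : normedModType R} {x : V} {f : V -> W * W'} :
  smooth_near x f -> smooth_near x (fun y => (f y).1).
Proof.
have lc : linear (fun p : W * W' => p.1) by [].
by apply: (smooth_near_linear (l := linear_of lc)) => p; exact: cvg_fst.
Qed.

Lemma smooth_near_pair0 {W W' : normedModType R} {x : V} {f : V -> W'} :
  smooth_near x f -> smooth_near x (fun y => (0 : W, f y)).
Proof.
have lc : linear (fun p : W' => (0 : W, p)).
  by move=> a p q; congr (_, _); rewrite /= scaler0 addr0.
apply: (smooth_near_linear (l := linear_of lc)) => p.
by apply: cvg_pair => //; exact: cvg_cst.
Qed.

Lemma smooth_near_mx {m n : nat} {x : V} {f : V -> 'M[R]_(m, n)} :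
  (forall i j, smooth_near x (fun y => f y i j)) -> smooth_near x f.
Proof.
move=> fs; rewrite (_ : f = fun y => \sum_i \sum_j f y i j *: delta_mx i j); last first.
  by apply/funext => y; exact: matrix_sum_delta.
apply: smooth_near_sum => i _; apply: smooth_near_sum => j _.
exact: smooth_near_scale (fs i j) (smooth_near_cst _).
Qed.

Lemma smooth_near_mulmx {m n p : nat} {x : V} {f : V -> 'M[R]_(m, n)}
    {g : V -> 'M[R]_(n, p)} :
  smooth_near x f -> smooth_near x g -> smooth_near x (fun y => f y *m g y).
Proof.
move=> fs gs; apply: smooth_near_mx => i j.
under eq_fun do rewrite mxE; apply: smooth_near_sum => k _.
exact: smooth_near_mul (smooth_near_coord _ _ fs) (smooth_near_coord _ _ gs).
Qed.

Lemma smooth_near_det {n : nat} {x : V} {f : V -> 'M[R]_n} :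
  (forall i j, smooth_near x (fun y => f y i j)) ->
  smooth_near x (fun y => \det (f y)).
Proof.
move=> fs; rewrite /determinant; apply: smooth_near_sum => s _.
by apply: smooth_near_mul; [exact: smooth_near_cst|exact: smooth_near_prod].
Qed.

(** Cramer's rule: the inverse is a rational expression in the entries. *)
Lemma smooth_near_invmx {n : nat} {x : V} {f : V -> 'M[R]_n} :
  f x \in unitmx -> smooth_near x f -> smooth_near x (fun y => invmx (f y)).
Proof.
move=> fx fs; have ds := smooth_near_det (fun i j => smooth_near_coord i j fs).
have dx : \det (f x) != 0 by rewrite -unitfE -unitmxE.
apply: (@smooth_near_eq _ _ (fun y => (\det (f y))^-1 *: \adj (f y))).
  have dc := differentiable_continuous (smooth_near_differentiable ds).
  have : \near x, \det (f x) != 0 by exact: (cvgr_neq0 _ dc dx).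
  by apply: filterS => y dy; rewrite /invmx unitmxE unitfE dy.
apply: smooth_near_scale (smooth_near_inv dx ds) _.
apply: smooth_near_mx => i j; under eq_fun do rewrite mxE /cofactor.
apply: smooth_near_mul; first exact: smooth_near_cst.
apply: smooth_near_det => i' j'.
by under eq_fun do rewrite !mxE; exact: smooth_near_coord.
Qed.

(** A derivative along a variable direction is a combination, with smooth
    coefficients, of derivatives along the finitely many basis vectors. *)
Lemma smooth_near_derive_along {W : normedModType R} {n : nat} {x : V}
    {a : V -> 'rV[R]_n} {f : V -> W} (i : {linear 'rV[R]_n -> V}) :
  smooth_near x a -> smooth_near x f ->
  smooth_near x (fun y => 'D_(i (a y)) f y).
Proof.
move=> as_ fs.
apply: (@smooth_near_eq _ _
  (fun y => \sum_j a y ord0 j *: 'D_(i (delta_mx ord0 j)) f y)).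
  apply: filterS (smooth_near_near fs) => y /smooth_near_differentiable df.
  rewrite [in RHS](row_sum_delta (a y)) !linear_sum deriveE // linear_sum.
  by apply: eq_bigr => j _; rewrite deriveE // !linearZ.
apply: smooth_near_sum => j _; apply: smooth_near_scale.
  exact: smooth_near_coord.
exact: smooth_near_derive.
Qed.

End SmoothNear.

(** * Charts and transition maps *)

Section Charts.
Context {R : realType} {n : nat} {M : topologicalType}.
Context {A : atlas 'rV[R]_n M} (mfd : is_smooth_manifold A).
Local Notation Rn := 'rV[R]_n.
Implicit Types (e c : chart_index A) (p q : M).

Lemma chart_invK {e p q} :
  chart_dom e q -> chart_inv e p (chart_map e q) = q.
Proof.
move=> eq; rewrite /chart_inv; case: xgetP => [r _ [er rq]|/(_ q) []//].
exact: (chart_inj mfd er eq).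
Qed.

Lemma near_chart_inv {e e' q} : chart_dom e q -> chart_dom e' q ->
  \forall x \near chart_map e q,
    exists2 r, chart_dom e r /\ chart_dom e' r & chart_map e r = x.
Proof.
move=> eq e'q.
have oU : open (chart_dom e `&` chart_dom e').
  by apply: openI; exact: (chart_dom_open mfd).
have oV := chart_open mfd oU (@subIsetl _ _ _).
have Vq : (chart_map e @` (chart_dom e `&` chart_dom e')) (chart_map e q) by exists q.
apply: filterS (open_nbhs_nbhs (conj oV Vq)) => x [r er <-]; by exists r.
Qed.

Lemma transition_smooth {e e'} p {q} : chart_dom e q -> chart_dom e' q ->
  smooth_near (chart_map e q) (chart_map e' \o chart_inv e p).
Proof.
move=> eq e'q; apply: smooth_near_eq (chart_transition mfd eq e'q).
apply: filterS (near_chart_inv eq e'q) => _ [r [er _] <-] /=.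
by rewrite !chart_invK.
Qed.

(** How the components of a tangent vector at q change from the chart e to the
    chart e'. *)
Definition transition_diff e e' q (z : Rn) : Rn :=
  'D_z (chart_map e' \o chart_inv e q) (chart_map e q).

(** The point p only fixes the value of the inverse chart off its image, which
    the germ at q does not see. *)
Lemma transition_diffE {e e'} p {q} z : chart_dom e q -> chart_dom e' q ->
  'D_z (chart_map e' \o chart_inv e p) (chart_map e q) = transition_diff e e' q z.
Proof.
move=> eq e'q; apply: near_eq_derive.
apply: filterS (near_chart_inv eq e'q) => _ [r [er _] <-] /=.
by rewrite !chart_invK.
Qed.

Lemma transition_diff_linear {e e' q} : chart_dom e q -> chart_dom e' q ->
  linear (transition_diff e e' q).
Proof.
move=> eq e'q a v w; apply: deriveDir.
exact: smooth_near_differentiable (transition_smooth q eq e'q).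
Qed.

Lemma transition_diff_id {e q z} : chart_dom e q -> transition_diff e e q z = z.
Proof.
move=> eq; rewrite -[RHS](derive_id (chart_map e q) z); apply: near_eq_derive.
apply: filterS (near_chart_inv eq eq) => _ [r [er _] <-] /=.
by rewrite !chart_invK.
Qed.

(** The cocycle rule, from which linearity and invertibility of the components
    maps follow. *)
Lemma transition_diff_comp {e e' e'' q z} :
  chart_dom e q -> chart_dom e' q -> chart_dom e'' q ->
  transition_diff e' e'' q (transition_diff e e' q z) = transition_diff e e'' q z.
Proof.
move=> eq e'q e''q.
have E : chart_map e' q = (chart_map e' \o chart_inv e q) (chart_map e q).
  by rewrite /= chart_invK.
rewrite {1}/transition_diff E /transition_diff -derive_comp.
- apply: near_eq_derive.
  apply: filterS (near_chart_inv eq e'q) => _ [r [er e'r] <-] /=.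
  by rewrite !chart_invK.
- exact: smooth_near_differentiable (transition_smooth q eq e'q).
- rewrite -E; exact: smooth_near_differentiable (transition_smooth q e'q e''q).
Qed.

Lemma transition_diffK {e e' q z} : chart_dom e q -> chart_dom e' q ->
  transition_diff e' e q (transition_diff e e' q z) = z.
Proof. by move=> eq e'q; rewrite transition_diff_comp // transition_diff_id. Qed.

Let at_dom p : chart_dom (chart_at A p) p := chart_at_dom mfd p.

Lemma componentsE e p : components e p = transition_diff (chart_at A p) e p.
Proof. by []. Qed.

Lemma components_at p v : components (chart_at A p) p v = v.
Proof. exact: transition_diff_id. Qed.

Lemma components_linear {e p} : chart_dom e p -> linear (components e p).
Proof. by move=> ep; exact: transition_diff_linear. Qed.

Lemma components_inj {e p} : chart_dom e p -> injective (components e p).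
Proof.
by move=> ep; apply: (can_inj (g := transition_diff e (chart_at A p) p)) => v;
  exact: transition_diffK.
Qed.

Lemma components_transition {e e' p v} : chart_dom e p -> chart_dom e' p ->
  components e' p v = transition_diff e e' p (components e p v).
Proof. by move=> ep e'p; rewrite !componentsE transition_diff_comp. Qed.

Lemma components_transition_diff {e p z} : chart_dom e p ->
  components e p (transition_diff e (chart_at A p) p z) = z.
Proof. by move=> ep; exact: transition_diffK. Qed.

End Charts.

(** * The slit tangent bundle *)

Section DeriveAffine.
Context {R : realType} {V W : normedModType R}.

Lemma cvg_line (a y : V) : (fun h : R => h *: a + y) @ (0 : R) --> y.
Proof.
rewrite -[X in _ --> X]add0r -(scale0r a); apply: cvgD; last exact: cvg_cst.
by apply: cvgZ; [exact: cvg_id|exact: cvg_cst].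
Qed.

Lemma near_line_neq0 (a y : V) : y != 0 -> \forall h \near (0 : R), h *: a + y != 0.
Proof. by move=> y0; exact: (cvgr_neq0 _ (@cvg_line a y) y0). Qed.

Lemma derive_affine {f : V -> W} {x v : V} {b : W} :
  (\forall h \near (0 : R), f (h *: v + x) = f x + h *: b) -> 'D_v f x = b.
Proof.
move=> fE; apply: lim_near_cst => //; rewrite near_withinE; near=> h => h0 /=.
rewrite (near fE h _) // addrAC subrr add0r scalerA mulVf ?scale1r //.
Unshelve. all: by end_near. Qed.

End DeriveAffine.

Lemma derive_fst {R : realType} {V W W' : normedModType R} {f : V -> W * W'}
    {x v : V} : differentiable f x -> ('D_v f x).1 = 'D_v (fun y => (f y).1) x.
Proof.
move=> df; have lc : linear (fun p : W * W' => p.1) by [].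
have cc : continuous (linear_of lc) by move=> p; exact: cvg_fst.
have := derive_comp (g := linear_of lc) v df (linear_differentiable _ cc).
by rewrite derive_lin.
Qed.

Section Slit.
Context {R : realType} {n : nat} {M : topologicalType}.
Context {A : atlas 'rV[R]_n M} (mfd : is_smooth_manifold A).
Local Notation Rn := 'rV[R]_n.
Local Notation SA := (slit_atlas A).
Local Notation slit := (slit R n M).
Implicit Types (e c : chart_index A) (p q : M) (u w : slit).

Let at_dom p : chart_dom (chart_at A p) p := chart_at_dom mfd p.

Lemma slit_chart_inj {e u w} : chart_dom e (slit_proj u) -> chart_dom e (slit_proj w) ->
  chart_map (a := SA) e u = chart_map (a := SA) e w -> u = w.
Proof.
move=> eu ew [] E; have E' := chart_inj mfd eu ew E.
move: u w eu ew E' {E} => [[p y] y0] [[p' z] z0]; rewrite /slit_proj /= => eu ew <-.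
by move=> /(components_inj mfd eu) E; apply: val_inj; rewrite /= E.
Qed.

Lemma slit_chart_invK {e u w} : chart_dom e (slit_proj w) ->
  chart_inv (A := SA) e u (chart_map (a := SA) e w) = w.
Proof.
move=> ew; rewrite /chart_inv; case: xgetP => [r _ [er rw]|/(_ w) []//].
exact: (slit_chart_inj er ew).
Qed.

Lemma slit_chart_surj {e q z} : chart_dom e q -> z != 0 ->
  exists2 w, slit_proj w = q & chart_map (a := SA) e w = (chart_map e q, z).
Proof.
move=> eq z0; pose y := transition_diff e (chart_at A q) q z.
have y0 : y != 0.
  apply/eqP => y0; move/eqP: z0; apply.
  by rewrite -(components_transition_diff mfd (z := z) eq) -/y y0 /components /tderive derive0.
exists (exist _ (q, y) y0) => //=.
by rewrite (components_transition_diff mfd eq).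
Qed.

(** The image of a chart of the slit tangent bundle is open: it is the product of
    the image of the chart of the base with the nonzero vectors, the fibre part
    being onto because the differential of a transition map is invertible. *)
Lemma near_slit_chart {e e' w} : chart_dom e (slit_proj w) -> chart_dom e' (slit_proj w) ->
  \forall x \near chart_map (a := SA) e w,
    exists2 r, chart_dom e (slit_proj r) /\ chart_dom e' (slit_proj r)
             & chart_map (a := SA) e r = x.
Proof.
move=> ew e'w.
have N1 := near_chart_inv mfd ew e'w.
have cw0 : components e (slit_proj w) (val w).2 != 0.
  have := valP w; apply: contra_neq => E.
  by apply: (components_inj mfd ew); rewrite E /components /tderive derive0.
have N2 : \forall z \near components e (slit_proj w) (val w).2, z != 0.
  exact: (cvgr_neq0 _ (@cvg_id _ _) cw0).
have : \forall x \near chart_map (a := SA) e w,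
   (exists2 r, chart_dom e r /\ chart_dom e' r & chart_map e r = x.1) /\ x.2 != 0.
  by exists ([set x | exists2 r, chart_dom e r /\ chart_dom e' r & chart_map e r = x],
           [set z | z != 0]).
apply: filterS => -[x z] /= [[r [er e'r] <-] z0].
have [w' w'r E] := slit_chart_surj er z0.
by exists w' => //; rewrite w'r.
Qed.

Lemma near_coord_at u :
  \forall x \near coord_at SA u,
    exists2 w, chart_dom (chart_at A (slit_proj u)) (slit_proj w)
      & x = chart_map (a := SA) (chart_at A (slit_proj u)) w
        /\ chart_inv (A := SA) (chart_at A (slit_proj u)) u x = w.
Proof.
apply: filterS (near_slit_chart (at_dom (slit_proj u)) (at_dom (slit_proj u))).
move=> _ [w [ew _] <-]; exists w => //; split => //; exact: slit_chart_invK.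
Qed.

Lemma coord_atE u :
  coord_at SA u = (chart_map (chart_at A (slit_proj u)) (slit_proj u), (val u).2).
Proof. by rewrite /coord_at /= (components_at mfd). Qed.

(** In the charts selected at u and at its base point, the projection is the
    first projection of a product. *)
Lemma rho_atE u x : rho_at A u x = x.1.
Proof.
rewrite /rho_at /tangent_map /tderive.
have lc : linear (fun p : Rn * Rn => p.1) by [].
rewrite -[RHS](derive_lin (l := linear_of lc) (coord_at SA u)); last by move=> p; exact: cvg_fst.
apply: near_eq_derive; apply: filterS (near_coord_at u) => y [w ew [-> E]].
by rewrite /in_chart_at /= slit_chart_invK.
Qed.

Lemma insubd_slit u q y : y != 0 -> val (insubd u (q, y) : slit) = (q, y).
Proof. by move=> y0; rewrite val_insubd /= y0. Qed.

Lemma near_val_neq0 u : \forall y \near (val u).2, y != 0.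
Proof. exact: (cvgr_neq0 _ (@cvg_id _ _) (valP u)). Qed.

(** In the chart selected at u the fibre through u is an affine line in the
    second factor, which the chart identifies with the tangent space itself. *)
Lemma gamma_atE u v : gamma_at A u v = (0, v).
Proof.
rewrite /gamma_at; apply: derive_affine.
apply: filterS (near_line_neq0 v (valP u : eta u != 0)) => h h0 /=.
rewrite /slit_proj (insubd_slit _ _ h0) (insubd_slit _ _ (valP u : eta u != 0)).
rewrite !(components_at mfd) /=; congr (_, _); rewrite /=.
  by rewrite scaler0 addr0.
have E y : y != 0 -> (sval (insubd u ((sval u).1, y))).2 = y.
  by move=> y0; rewrite [sval _](insubd_slit _ _ y0).
by rewrite (E _ h0) (E _ (valP u)) addrC.
Qed.

Section Transition.
Variables (e e' : chart_index A) (u w : slit).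
Hypotheses (ew : chart_dom e (slit_proj w)) (e'w : chart_dom e' (slit_proj w)).
Let tau := chart_map e' \o chart_inv e (slit_proj w).
Let slit_tau (x : Rn * Rn) : Rn * Rn := (tau x.1, 'D_(x.2) tau x.1).

Let tau_smooth : smooth_near (chart_map e (slit_proj w)) tau.
Proof. exact: transition_smooth. Qed.

Lemma slit_transition_near :
  \forall x \near chart_map (a := SA) e w,
    slit_tau x = (chart_map (a := SA) e' \o chart_inv (A := SA) e u) x.
Proof.
apply: filterS (near_slit_chart ew e'w) => _ [r [er e'r] <-].
rewrite /slit_tau /tau /= (chart_invK mfd er) (slit_chart_invK er).
by rewrite (transition_diffE mfd _ _ er e'r) -(components_transition mfd er e'r).
Qed.

(** The second component is linear in the fibre coordinate with coefficients the
    partial derivatives of the base transition, which are smooth. *)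
Lemma slit_tau_differentiable : differentiable slit_tau (chart_map (a := SA) e w).
Proof.
have l1 : linear (fun p : Rn * Rn => p.1) by [].
have l2 : linear (fun p : Rn * Rn => p.2) by [].
have c1 : continuous (linear_of l1) by move=> p; exact: cvg_fst.
have c2 : continuous (linear_of l2) by move=> p; exact: cvg_snd.
have d1 y : differentiable (linear_of l1) y by exact: linear_differentiable.
have d2 y : differentiable (linear_of l2) y by exact: linear_differentiable.
apply: differentiable_pair.
  apply: (differentiable_comp (d1 _)); exact: smooth_near_differentiable tau_smooth.
apply: (@differentiable_near_eq _ _ _
  (fun x : Rn * Rn => \sum_j x.2 ord0 j *: 'D_(delta_mx ord0 j) tau x.1)).
  have fc : (fun x : Rn * Rn => x.1) @ chart_map (a := SA) e w --> chart_map e (slit_proj w).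
    exact: cvg_fst.
  have : \forall x \near chart_map (a := SA) e w, smooth_near x.1 tau.
    exact: fc (smooth_near_near tau_smooth).
  apply: filterS => x /smooth_near_differentiable dx.
  rewrite [in RHS](row_sum_delta x.2) deriveE // linear_sum.
  by apply: eq_bigr => j _; rewrite deriveE // !linearZ.
rewrite (_ : (fun x => _) = \sum_j (fun x : Rn * Rn => x.2 ord0 j *: 'D_(delta_mx ord0 j) tau x.1)); last first.
  by apply/funext => x; rewrite fct_sumE.
apply: differentiable_sum => j; apply: differentiable_scale.
  apply: (@differentiable_comp _ _ _ _ (linear_of l2) (fun y : Rn => y ord0 j)) => //.
  exact: differentiable_coord.
apply: (@differentiable_comp _ _ _ _ (linear_of l1) ('D_(delta_mx ord0 j) tau)) => //.
exact: smooth_near_differentiable (smooth_near_derive _ tau_smooth).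
Qed.

Lemma slit_transition_differentiable :
  differentiable (chart_map (a := SA) e' \o chart_inv (A := SA) e u)
    (chart_map (a := SA) e w).
Proof. exact: differentiable_near_eq slit_transition_near slit_tau_differentiable. Qed.

(** Transitions cover those of the base, so the first component transforms like a
    tangent vector of the base. *)
Lemma slit_transition_fst (v : Rn * Rn) :
  ('D_v (chart_map (a := SA) e' \o chart_inv (A := SA) e u)
     (chart_map (a := SA) e w)).1 = 'D_(v.1) tau (chart_map e (slit_proj w)).
Proof.
rewrite -(near_eq_derive _ slit_transition_near).
rewrite (derive_fst slit_tau_differentiable) /=.
have l1 : linear (fun p : Rn * Rn => p.1) by [].
have c1 : continuous (linear_of l1) by move=> p; exact: cvg_fst.
rewrite (derive_comp (f := linear_of l1) (g := tau)) ?derive_lin //.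
  exact: linear_differentiable.
exact: smooth_near_differentiable tau_smooth.
Qed.

(** Along a fibre the transition is affine, so its derivative is exact and keeps
    vertical vectors vertical. *)
Lemma slit_transition_vertical (v : Rn) :
  'D_(0, v) (chart_map (a := SA) e' \o chart_inv (A := SA) e u)
     (chart_map (a := SA) e w) = (0, 'D_v tau (chart_map e (slit_proj w))).
Proof.
rewrite -(near_eq_derive _ slit_transition_near).
apply: derive_affine; near=> h; rewrite /slit_tau /=.
have d := smooth_near_differentiable tau_smooth.
rewrite scaler0 add0r (deriveDir _ _ _ d); congr (_, _) => /=.
  by rewrite scaler0 addr0.
by rewrite addrC.
Unshelve. all: by end_near. Qed.

End Transition.

Lemma slit_components_linear {e w} : chart_dom e (slit_proj w) ->
  linear (components (A := SA) e w).
Proof.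
move=> ew a v v'; apply: deriveDir.
exact: slit_transition_differentiable (at_dom _) ew.
Qed.

Lemma slit_components_fst {e w} v : chart_dom e (slit_proj w) ->
  (components (A := SA) e w v).1 = components e (slit_proj w) v.1.
Proof. by move=> ew; exact: slit_transition_fst (at_dom _) ew v. Qed.

Lemma slit_components_vertical {e w} v : chart_dom e (slit_proj w) ->
  components (A := SA) e w (0, v) = (0, components e (slit_proj w) v).
Proof. by move=> ew; exact: slit_transition_vertical (at_dom _) ew v. Qed.

End Slit.

(** * Smooth fields and vertical brackets *)

Section DeriveLine.
Context {R : realType} {V V' W : normedModType R}.

(** Directional derivatives only see the restrictions to lines. *)
Lemma derive_line {f : V -> W} {g : V' -> W} {x v x' v'} :
  (\forall h \near (0 : R), f (h *: v + x) = g (h *: v' + x')) ->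
  'D_v f x = 'D_v' g x'.
Proof.
move=> fg; have := nbhs_singleton fg; rewrite /= !scale0r !add0r => fg0.
rewrite /derive; congr (lim _).
have E : \forall h \near 0^', h^-1 *: ((f \o shift x) (h *: v) - f x) =
    h^-1 *: ((g \o shift x') (h *: v') - g x').
  rewrite near_withinE; apply: filterS fg => h fgh _ /=; by rewrite fgh fg0.
rewrite eqEsubset; split; apply: near_eq_cvg => //.
by apply: filterS E => h ->.
Qed.

End DeriveLine.

Lemma derive_pair0 {R : realType} {V W W' : normedModType R} {f : V -> W'}
    {x v : V} : differentiable f x -> 'D_v (fun y => (0 : W, f y)) x = (0, 'D_v f x).
Proof.
move=> df.
have dp : differentiable (fun y => (0 : W, f y)) x.
  by apply: differentiable_pair df; exact: differentiable_cst.
rewrite (deriveE _ dp) (diff_pair (differentiable_cst _ _) df) -(deriveE _ df).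
by rewrite -(deriveE _ (differentiable_cst _ _)) derive_cst.
Qed.

Section Fields.
Context {R : realType} {n : nat} {M : topologicalType}.
Context {A : atlas 'rV[R]_n M} (mfd : is_smooth_manifold A).
Local Notation Rn := 'rV[R]_n.
Local Notation SA := (slit_atlas A).
Local Notation slit := (slit R n M).
Local Notation vfield := (slit -> Rn * Rn).
Local Notation pi_vfield := (slit -> Rn).
Implicit Types (e c : chart_index A) (p q : M) (u w : slit).

Let at_dom p : chart_dom (chart_at A p) p := chart_at_dom mfd p.

Lemma rhoE (X : vfield) w : rho A X w = (X w).1.
Proof. exact: (rho_atE mfd). Qed.

Lemma gammaE (X : pi_vfield) w : gamma A X w = (0, X w).
Proof. exact: (gamma_atE mfd). Qed.

Definition pi_components e (X : pi_vfield) : slit -> Rn :=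
  fun w => components e (slit_proj w) (X w).

(** Smoothness at u of a function on the slit tangent bundle, checked on the points
    of the chart domain instead of their coordinates. *)
Lemma smooth_near_coord_at {W : normedModType R} u (f : slit -> W)
    (g : Rn * Rn -> W) :
  smooth_near (coord_at SA u) g ->
  (forall w, chart_dom (chart_at A (slit_proj u)) (slit_proj w) ->
     g (chart_map (a := SA) (chart_at A (slit_proj u)) w) = f w) ->
  smooth_at SA u f.
Proof.
move=> gs gf; apply: smooth_near_eq gs.
apply: filterS (near_coord_at mfd u) => x [w ew [-> E]].
by rewrite /in_chart_at /= E gf.
Qed.

Lemma eta_smooth : smooth_pi_vfield A (@eta R n M).
Proof.
move=> u; have lc : linear (fun p : Rn * Rn => p.2) by [].
have cc : continuous (linear_of lc) by move=> p; exact: cvg_snd.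
exact: (smooth_near_coord_at (smooth_near_lin cc)).
Qed.

Lemma rho_smooth (X : vfield) : smooth_vfield SA X -> smooth_pi_vfield A (rho A X).
Proof.
move=> Xs u; apply: (smooth_near_coord_at (smooth_near_fst (Xs u))) => w ew.
by rewrite /in_chart_at /= (slit_chart_invK mfd ew) rhoE -(slit_components_fst mfd).
Qed.

Lemma gamma_smooth (X : pi_vfield) :
  smooth_pi_vfield A X -> smooth_vfield SA (gamma A X).
Proof.
move=> Xs u; apply: (smooth_near_coord_at (smooth_near_pair0 (W := Rn) (Xs u))) => w ew.
by rewrite /in_chart_at /= (slit_chart_invK mfd ew) gammaE -(slit_components_vertical mfd).
Qed.

Lemma vfield_lin_smooth (a : R) (X Y : vfield) : smooth_vfield SA X -> smooth_vfield SA Y ->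
  smooth_vfield SA (fun w => a *: X w + Y w).
Proof.
move=> Xs Ys u.
apply: (smooth_near_coord_at (smooth_near_add (smooth_near_scale (smooth_near_cst a) (Xs u)) (Ys u))) => w ew.
by rewrite /in_chart_at /= (slit_chart_invK mfd ew) -(slit_components_linear mfd).
Qed.

Lemma vfield0_smooth : smooth_vfield SA (fun=> 0).
Proof.
move=> u; apply: (smooth_near_coord_at (smooth_near_cst 0)) => w ew.
by rewrite /components /tderive derive0.
Qed.

Lemma pi_vfield_lin_smooth (a : R) (X Y : pi_vfield) :
  smooth_pi_vfield A X -> smooth_pi_vfield A Y ->
  smooth_pi_vfield A (fun w => a *: X w + Y w).
Proof.
move=> Xs Ys u.
apply: (smooth_near_coord_at (smooth_near_add (smooth_near_scale (smooth_near_cst a) (Xs u)) (Ys u))) => w ew.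
by rewrite /in_chart_at /= (slit_chart_invK mfd ew) -(components_linear mfd).
Qed.

Lemma pi_vfield0_smooth : smooth_pi_vfield A (fun=> 0).
Proof.
move=> u; apply: (smooth_near_coord_at (smooth_near_cst 0)) => w ew.
by rewrite /components /tderive derive0.
Qed.

(** On a fibre the change of components is a fixed linear map, so it commutes with
    vertical differentiation.  A derivative in a general direction would also
    differentiate that map. *)
Lemma vertical_derive {e w} u {X : pi_vfield} (a : Rn) : smooth_pi_vfield A X ->
  chart_dom e (slit_proj w) ->
  'D_(0, components e (slit_proj w) a)
     (pi_components e X \o chart_inv (A := SA) e u) (chart_map (a := SA) e w)
  = components e (slit_proj w)
      (tderive SA (pi_components (chart_at A (slit_proj w)) X) w (0, a)).
Proof.
move=> Xs ew; set p := slit_proj w; set c := chart_at A p.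
have dt : differentiable (chart_map e \o chart_inv c p) (chart_map c p).
  exact: smooth_near_differentiable (transition_smooth mfd _ (at_dom p) ew).
have TE : components e p = 'd (chart_map e \o chart_inv c p) (chart_map c p) :> (Rn -> Rn).
  by apply/funext => v; rewrite -deriveE.
have dX := smooth_near_differentiable (Xs w).
have dT y : differentiable (components e p) y.
  by rewrite TE; apply: linear_differentiable; exact: diff_continuous.
have DT y v : 'D_v (components e p) y = components e p v.
  by rewrite TE derive_lin //; exact: diff_continuous.
rewrite /tderive -[RHS](DT (in_chart_at SA w (pi_components c X) (coord_at SA w))).
have dX' : differentiable (in_chart_at SA w (pi_components c X)) (coord_at SA w) by exact: dX.
rewrite -(derive_comp (0, a) dX' (dT _)); apply: derive_line.
apply: filterS (near_line_neq0 a (valP w)) => h h0; pose r : slit := exist _ (p, h *: a + (val w).2) h0.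
have Er : h *: (0, components e p a) + chart_map (a := SA) e w = chart_map (a := SA) e r.
  rewrite /= (components_linear mfd ew); congr (_, _).
  by rewrite /= scaler0 add0r.
have Cr : h *: (0, a) + coord_at SA w = chart_map (a := SA) c r.
  rewrite (coord_atE mfd) /= (components_at mfd); congr (_, _).
  by rewrite /= scaler0 add0r.
rewrite Er Cr /= /in_chart_at /= (slit_chart_invK mfd (w := r) ew).
by rewrite (slit_chart_invK mfd (w := r) (at_dom p)) /pi_components (components_at mfd).
Qed.

(** The bracket of X and Y restricted to a fibre, read as vector fields on that
    vector space. *)
Definition fibre_bracket (X Y : pi_vfield) : pi_vfield := fun w =>
  tderive SA (pi_components (chart_at A (slit_proj w)) Y) w (0, X w)
  - tderive SA (pi_components (chart_at A (slit_proj w)) X) w (0, Y w).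

Lemma tderive_gamma (X : pi_vfield) w v : smooth_pi_vfield A X ->
  tderive SA (fun r => components (A := SA) (chart_at SA w) r (gamma A X r)) w v
  = (0, tderive SA (pi_components (chart_at A (slit_proj w)) X) w v).
Proof.
move=> Xs; rewrite -(derive_pair0 (W := Rn) (smooth_near_differentiable (Xs w))).
apply: near_eq_derive; apply: filterS (near_coord_at mfd w) => x [r er [_ E]].
by rewrite /in_chart_at /= E gammaE (slit_components_vertical mfd _ er).
Qed.

(** Vertical fields are tangent to the fibres, so their bracket is computed
    fibre by fibre. *)
Lemma lie_bracket_gamma (X Y : pi_vfield) :
  smooth_pi_vfield A X -> smooth_pi_vfield A Y ->
  lie_bracket SA (gamma A X) (gamma A Y) = gamma A (fibre_bracket X Y).
Proof.
move=> Xs Ys; apply/funext => w.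
have := congr2 (fun a b => a - b) (tderive_gamma w (gamma A X w) Ys)
  (tderive_gamma w (gamma A Y w) Xs).
rewrite (gammaE X w) (gammaE Y w) => E.
rewrite /lie_bracket (gammaE X w) (gammaE Y w) [LHS]E (gammaE _ w).
by rewrite /fibre_bracket; congr (_, _); rewrite /= subr0.
Qed.

(** The definition of the bracket changes chart with the point.  Because vertical
    differentiation commutes with changes of components, near u it may be
    evaluated in the single chart selected at u. *)
Lemma fibre_bracket_smooth (X Y : pi_vfield) :
  smooth_pi_vfield A X -> smooth_pi_vfield A Y ->
  smooth_pi_vfield A (fibre_bracket X Y).
Proof.
move=> Xs Ys u.
have lc : linear (fun z : Rn => (0 : Rn, z)).
  by move=> a p q; congr (_, _); rewrite /= scaler0 addr0.
have S1 := smooth_near_derive_along (linear_of lc) (Xs u) (Ys u).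
have S2 := smooth_near_derive_along (linear_of lc) (Ys u) (Xs u).
have S3 := smooth_near_add S1 (smooth_near_scale (smooth_near_cst (-1 : R)) S2).
apply: (smooth_near_coord_at S3) => w ew.
have E := congr2 (fun a b => a + -1 *: b) (vertical_derive u (X w) Ys ew)
  (vertical_derive u (Y w) Xs ew).
rewrite /in_chart_at /= !(slit_chart_invK mfd ew).
apply: etrans E _.
rewrite addrC -(components_linear mfd ew) /fibre_bracket scaleN1r.
by rewrite addrC.
Qed.

End Fields.

(** * Linear connections and their horizontal subspaces *)

(** Only combinations with constant coefficients occur: they are global smooth
    fields, to which the linearity of the connection applies directly. *)
Definition lincomb {R : realType} {m : nat} {T : Type} {W : lmodType R}
    (c : 'rV[R]_m) (F : 'I_m -> T -> W) : T -> W :=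
  fun w => \sum_i c ord0 i *: F i w.

Section ConnectionTheory.
Context {R : realType} {n : nat} {M : topologicalType}.
Context {A : atlas 'rV[R]_n M} (mfd : is_smooth_manifold A).
Local Notation Rn := 'rV[R]_n.
Local Notation SA := (slit_atlas A).
Local Notation slit := (slit R n M).
Local Notation vfield := (slit -> Rn * Rn).
Local Notation pi_vfield := (slit -> Rn).
Implicit Types (e c : chart_index A) (p q : M) (u w : slit).

Let at_dom p : chart_dom (chart_at A p) p := chart_at_dom mfd p.

Lemma cst_smooth (a : R) : smooth SA (fun=> a).
Proof. by move=> u; exact: smooth_near_cst. Qed.

Lemma vfield_scale_smooth (a : R) (X : vfield) : smooth_vfield SA X ->
  smooth_vfield SA (fun w => a *: X w).
Proof.
move=> Xs; have := vfield_lin_smooth mfd a Xs (vfield0_smooth mfd).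
by congr smooth_vfield; apply/funext => w; rewrite addr0.
Qed.

Lemma lincomb_vfield_smooth m (a : 'rV[R]_m) (X : 'I_m -> vfield) :
  (forall i, smooth_vfield SA (X i)) -> smooth_vfield SA (lincomb a X).
Proof.
move=> Xs; rewrite /lincomb; elim: (index_enum _) => [|i r IH].
  have := vfield0_smooth mfd; congr smooth_vfield.
  by apply/funext => w; rewrite big_nil.
have := vfield_lin_smooth mfd (a ord0 i) (Xs i) IH; congr smooth_vfield.
by apply/funext => w; rewrite big_cons.
Qed.

Lemma lincomb_pi_vfield_smooth m (a : 'rV[R]_m) (X : 'I_m -> pi_vfield) :
  (forall i, smooth_pi_vfield A (X i)) -> smooth_pi_vfield A (lincomb a X).
Proof.
move=> Xs; rewrite /lincomb; elim: (index_enum _) => [|i r IH].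
  have := pi_vfield0_smooth mfd; congr smooth_pi_vfield.
  by apply/funext => w; rewrite big_nil.
have := pi_vfield_lin_smooth mfd (a ord0 i) (Xs i) IH; congr smooth_pi_vfield.
by apply/funext => w; rewrite big_cons.
Qed.

Lemma gamma_lincomb m (a : 'rV[R]_m) (X : 'I_m -> pi_vfield) :
  gamma A (lincomb a X) = lincomb a (fun i => gamma A (X i)).
Proof.
apply/funext => w; rewrite (gammaE mfd) /lincomb.
have lc : linear (fun z : Rn => (0 : Rn, z)).
  by move=> b p q; congr (_, _); rewrite /= scaler0 addr0.
rewrite -[LHS]/(linear_of lc _) linear_sum; apply: eq_bigr => i _.
by rewrite linearZ (gammaE mfd).
Qed.

Context {D : vfield -> pi_vfield -> pi_vfield} (conn : is_connection A D).

Lemma conn_lin (a : R) (X Y : vfield) (Z : pi_vfield) u :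
  smooth_vfield SA X -> smooth_vfield SA Y -> smooth_pi_vfield A Z ->
  D (fun w => a *: X w + Y w) Z u = a *: D X Z u + D Y Z u.
Proof.
move=> Xs Ys Zs.
have E1 := conn_addl conn (vfield_scale_smooth a Xs) Ys Zs u.
have E2 := conn_scalel conn (cst_smooth a) Xs Zs u.
exact: etrans E1 (congr1 (fun z => z + _) E2).
Qed.

Lemma conn0l (Z : pi_vfield) u : smooth_pi_vfield A Z -> D (fun=> 0) Z u = 0.
Proof.
move=> Zs; have := conn_scalel conn (cst_smooth 0) (vfield0_smooth mfd) Zs u.
by rewrite [RHS]scale0r => <-; congr (D _ Z u); apply/funext => w; rewrite scaler0.
Qed.

Lemma conn0r (X : vfield) u : smooth_vfield SA X -> D X (fun=> 0) u = 0.
Proof.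
move=> Xs; have E := conn_leibniz conn (cst_smooth 0) Xs (pi_vfield0_smooth mfd) u.
by rewrite !scaler0 scale0r addr0 in E.
Qed.

Lemma conn_lincomb m (a : 'rV[R]_m) (X : 'I_m -> vfield) (Z : pi_vfield) u :
  (forall i, smooth_vfield SA (X i)) -> smooth_pi_vfield A Z ->
  D (lincomb a X) Z u = \sum_i a ord0 i *: D (X i) Z u.
Proof.
move=> Xs Zs; rewrite /lincomb.
suff [] : smooth_vfield SA (fun w => \sum_i a ord0 i *: X i w) /\
  D (fun w => \sum_i a ord0 i *: X i w) Z u = \sum_i a ord0 i *: D (X i) Z u by [].
elim: (index_enum _) => [|i r [IHs IH]].
  rewrite (_ : (fun w => _) = fun=> 0); last by apply/funext => w; rewrite big_nil.
  by rewrite big_nil conn0l //; split => //; exact: vfield0_smooth.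
rewrite (_ : (fun w => _) = fun w => a ord0 i *: X i w + \sum_(i <- r) a ord0 i *: X i w); last first.
  by apply/funext => w; rewrite big_cons.
split; first exact: (vfield_lin_smooth mfd (a ord0 i) (Xs i) IHs).
have E := conn_lin (a ord0 i) u (Xs i) IHs Zs.
by rewrite big_cons -IH.
Qed.

Context (reg : regular A D).

Lemma connection_ker_lin (a : R) u h k : connection_ker A D u h ->
  connection_ker A D u k -> connection_ker A D u (a *: h + k).
Proof.
move=> [X [Xs <- X0]] [Y [Ys <- Y0]]; 
have E := conn_lin a u Xs Ys (eta_smooth mfd).
exists (fun w => a *: X w + Y w); split.
- exact: (vfield_lin_smooth mfd a Xs Ys).
- by [].
- by apply: etrans E _; rewrite [D X _ _]X0 [D Y _ _]Y0 scaler0 addr0.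
Qed.

Lemma connection_ker0 u : connection_ker A D u 0.
Proof.
exists (fun=> 0); split => //; first exact: vfield0_smooth.
exact: conn0l (eta_smooth mfd).
Qed.

(** Uniqueness of the decomposition: h would have the two decompositions 0 + h and
    h + 0. *)
Lemma connection_ker_vertical u h : connection_ker A D u h -> h.1 = 0 -> h = 0.
Proof.
move=> hk h0; have [vh [_ uniq_vh]] := reg u h.
have E1 : vh = (0, h).
  by apply: uniq_vh; split; rewrite /= ?add0r //; rewrite /vertical /= (rho_atE mfd).
have E2 : vh = (h, 0).
  apply: uniq_vh; split; rewrite /= ?addr0 //; last exact: connection_ker0.
  by rewrite /vertical /= (rho_atE mfd).
by have := E2; rewrite E1 => -[_ ->].
Qed.

(** The projection is injective on the kernel of the connection map, so any
    element of the kernel with the right projection is the value of beta. *)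
Lemma betaE (X : pi_vfield) u h : connection_ker A D u h -> h.1 = X u ->
  beta A D X u = h.
Proof.
move=> hk hX; rewrite /beta; case: xgetP => [k _ [kk kX]|/(_ h)]; last first.
  by case; split => //; rewrite (rho_atE mfd).
apply/eqP; rewrite -subr_eq0 addrC -scaleN1r; apply/eqP.
apply: (@connection_ker_vertical u); first exact: connection_ker_lin.
by move: kX; rewrite (rho_atE mfd) /= hX => ->; rewrite scaleN1r addNr.
Qed.

(** Regularity alone produces enough global fields: the horizontal part of a
    tangent vector is by definition the value of a smooth vector field. *)
Lemma vfield_through u (v : Rn) : exists X : vfield, smooth_vfield SA X /\ (X u).1 = v.
Proof.
have [vh [[V0 [X [Xs XE _]] xE] _]] := reg u (v, 0).
exists X; split => //; rewrite XE.
have := congr1 fst xE; move: V0; rewrite /vertical /= (rho_atE mfd) => ->.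
by rewrite add0r.
Qed.

Lemma exists_pi_vfield_through u (v : Rn) :
  exists X : pi_vfield, smooth_pi_vfield A X /\ X u = v.
Proof.
have [X [Xs XE]] := vfield_through u v.
exists (rho A X); split; first exact: rho_smooth.
by rewrite (rhoE mfd).
Qed.

Definition frame_mx e (F : 'I_n -> pi_vfield) w : 'M[R]_n :=
  \matrix_(i, j) components e (slit_proj w) (F i w) ord0 j.

(** Coefficients act as row vectors on the left, hence systems for them are solved
    by multiplying by an inverse matrix on the right. *)
Lemma mul_frame_mx e (F : 'I_n -> pi_vfield) w (a : Rn) : chart_dom e (slit_proj w) ->
  a *m frame_mx e F w = components e (slit_proj w) (lincomb a F w).
Proof.
move=> ew; rewrite /lincomb -[RHS]/(linear_of (components_linear mfd ew) _) linear_sum.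
rewrite mulmx_sum_row; apply: eq_bigr => i _; rewrite linearZ; congr (_ *: _).
by apply/rowP => j; rewrite !mxE.
Qed.

Lemma frame_mx_smooth (F : 'I_n -> pi_vfield) u :
  (forall i, smooth_pi_vfield A (F i)) ->
  smooth_at SA u (frame_mx (chart_at A (slit_proj u)) F).
Proof.
move=> Fs; apply: smooth_near_mx => i j.
have := smooth_near_coord ord0 j (Fs i u).
by congr smooth_near; apply/funext => x; rewrite /in_chart_at /= mxE.
Qed.

(** The connection map is injective on vertical vectors: a combination killed by
    it would be both vertical and in its kernel. *)
Lemma vertical_frame_unitmx {e} (F : 'I_n -> pi_vfield) w : chart_dom e (slit_proj w) ->
  (forall i, smooth_pi_vfield A (F i)) ->
  frame_mx e F w \in unitmx ->
  frame_mx e (fun i => connection_map D (gamma A (F i))) w \in unitmx.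
Proof.
move=> ew Fs Fu; rewrite -row_free_unit; apply: inj_row_free => a.
rewrite mul_frame_mx // => aK.
have aK0 : lincomb a (fun i => connection_map D (gamma A (F i))) w = 0.
  apply: (components_inj mfd ew); rewrite aK.
  by rewrite -[LHS](linear0 (linear_of (components_linear mfd ew))).
have aF0 : gamma A (lincomb a F) w = 0.
  apply: (@connection_ker_vertical w); last by rewrite (gammaE mfd).
  exists (gamma A (lincomb a F)); split => //.
    by apply: gamma_smooth => //; exact: lincomb_pi_vfield_smooth.
  rewrite gamma_lincomb -[RHS]aK0; apply: conn_lincomb; last exact: eta_smooth.
  by move=> i; exact: gamma_smooth.
have : a *m frame_mx e F w = 0.
  have aF : lincomb a F w = 0 by have := congr1 snd aF0; rewrite (gammaE mfd).
  rewrite (mul_frame_mx F a ew) aF.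
  exact: (linear0 (linear_of (components_linear mfd ew))).
by move/(congr1 (mulmx^~ (invmx (frame_mx e F w)))); rewrite mulmxK // mul0mx.
Qed.

End ConnectionTheory.

(** * Smoothness of the horizontal map *)

Lemma near_unitmx {R : realType} {V : normedModType R} {m : nat} {x : V} {f : V -> 'M[R]_m} :
  smooth_near x f -> f x \in unitmx -> \forall y \near x, f y \in unitmx.
Proof.
move=> fs; have ds := smooth_near_det (fun i j => smooth_near_coord i j fs).
have dc := differentiable_continuous (smooth_near_differentiable ds).
rewrite unitmxE unitfE => dx.
have : \forall y \near x, \det (f y) != 0 by exact: (cvgr_neq0 _ dc dx).
by apply: filterS => y; rewrite unitmxE unitfE.
Qed.

Section Beta.
Context {R : realType} {n : nat} {M : topologicalType}.
Context {A : atlas 'rV[R]_n M} (mfd : is_smooth_manifold A).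
Local Notation Rn := 'rV[R]_n.
Local Notation SA := (slit_atlas A).
Local Notation slit := (slit R n M).
Local Notation vfield := (slit -> Rn * Rn).
Local Notation pi_vfield := (slit -> Rn).
Implicit Types (e c : chart_index A) (p q : M) (u w : slit).
Context {D : vfield -> pi_vfield -> pi_vfield} (conn : is_connection A D).
Context (reg : regular A D).

Let at_dom p : chart_dom (chart_at A p) p := chart_at_dom mfd p.

(** Start from any combination of the H i with projection X w, and subtract the
    vertical combination with the same image under the connection map.  The
    coefficients depend on w but are frozen once w is chosen, so the result is the
    value at w of a global field whose image under the connection map vanishes at
    w, as membership in the kernel requires. *)
Lemma beta_frame {e w} (H : 'I_n -> vfield) (X : pi_vfield) :
  (forall i, smooth_vfield SA (H i)) -> chart_dom e (slit_proj w) ->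
  let E i := rho A (H i) in
  let Em := frame_mx e E w in
  let Km := frame_mx e (fun i => connection_map D (gamma A (E i))) w in
  let Hm := frame_mx e (fun i => connection_map D (H i)) w in
  Em \in unitmx -> Km \in unitmx ->
  let xi := components e (slit_proj w) (X w) *m invmx Em in
  beta A D X w = - 1 *: lincomb (xi *m Hm *m invmx Km) (fun i => gamma A (E i)) w
                 + lincomb xi H w.
Proof.
move=> Hs ew E Em Km Hm Emu Kmu xi; set al := xi *m Hm *m invmx Km.
have Es i : smooth_pi_vfield A (E i) by exact: (rho_smooth mfd (Hs i)).
have Gs i : smooth_vfield SA (gamma A (E i)) by exact: (gamma_smooth mfd (Es i)).
have lGs := lincomb_vfield_smooth mfd al Gs.
have lHs := lincomb_vfield_smooth mfd xi Hs.
apply: (betaE mfd conn reg).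
  exists (fun w => -1 *: lincomb al (fun i => gamma A (E i)) w + lincomb xi H w).
  split; [exact: (vfield_lin_smooth mfd (-1) lGs lHs)|by []|].
  apply: etrans (conn_lin mfd conn (-1) w lGs lHs (eta_smooth mfd)) _.
  rewrite (conn_lincomb mfd conn _ _ Gs (eta_smooth mfd)).
  rewrite (conn_lincomb mfd conn _ _ Hs (eta_smooth mfd)).
  apply: (components_inj mfd ew).
  rewrite (components_linear mfd ew).
  have E1 := mul_frame_mx mfd (fun i => connection_map D (gamma A (E i))) al ew.
  have E2 := mul_frame_mx mfd (fun i => connection_map D (H i)) xi ew.
  apply: etrans (congr2 (fun a b => -1 *: a + b) (esym E1) (esym E2)) _.
  have c0 : components e (slit_proj w) 0 = 0.
    exact: linear0 (linear_of (components_linear mfd ew)).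
  have E3 : al *m Km = xi *m Hm by exact: mulmxKV.
  apply: etrans (congr1 (fun z => -1 *: z + xi *m Hm) E3) _.
  by apply: etrans (esym c0); rewrite scaleN1r addNr.
have -> : (-1 *: lincomb al (fun i => gamma A (E i)) w + lincomb xi H w).1
    = lincomb xi E w.
  have l1 : linear (fun p : Rn * Rn => p.1) by [].
  have G : lincomb al (fun i => gamma A (E i)) w = (0, lincomb al E w).
    exact: etrans (congr1 (fun F => F w) (esym (gamma_lincomb mfd al E))) (gammaE mfd _ w).
  have L1 : (lincomb xi H w).1 = lincomb xi E w.
    rewrite -[LHS]/(linear_of l1 _) linear_sum; apply: eq_bigr => i _.
    by rewrite linearZ /=; congr (_ *: _); rewrite /E (rhoE mfd).
  have fst_lin (a b : Rn * Rn) : (-1 *: a + b).1 = -1 *: a.1 + b.1 by [].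
  apply: etrans (fst_lin _ _) _.
  apply: etrans (congr2 (fun a b => -1 *: a + b) (congr1 fst G) L1) _.
  by rewrite scaler0 add0r.
apply: (components_inj mfd ew).
have E4 : xi *m Em = components e (slit_proj w) (X w).
  exact: (mulmxKV Emu (components e (slit_proj w) (X w))).
have E5 := mul_frame_mx mfd E xi ew.
apply: etrans (esym E5) _.
exact: E4.
Qed.

Lemma frame_mx_rho_id (H : 'I_n -> vfield) u :
  (forall i, (H i u).1 = delta_mx ord0 i) ->
  frame_mx (chart_at A (slit_proj u)) (fun i => rho A (H i)) u = 1%:M.
Proof.
move=> HE; apply/matrixP => i j.
by rewrite mxE (components_at mfd) (rhoE mfd) HE !mxE eqxx eq_sym.
Qed.

Lemma slit_components_lincomb {e w} m (a : 'rV[R]_m) (X : 'I_m -> vfield) :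
  chart_dom e (slit_proj w) ->
  components (A := SA) e w (lincomb a X w)
  = \sum_i a ord0 i *: components (A := SA) e w (X i w).
Proof.
move=> ew; rewrite -[LHS]/(linear_of (slit_components_linear mfd ew) _) linear_sum.
by apply: eq_bigr => i _; rewrite linearZ.
Qed.

(** Near u the coefficients of [beta_frame] solve linear systems whose matrices are
    smooth and invertible at u. *)
Lemma beta_smooth (X : pi_vfield) :
  smooth_pi_vfield A X -> smooth_vfield SA (beta A D X).
Proof.
move=> Xs u; set e := chart_at A (slit_proj u).
have [H HP] := choice (fun i : 'I_n => vfield_through mfd reg u (delta_mx ord0 i)).
have Hs i : smooth_vfield SA (H i) by have [] := HP i.
have Hu i : (H i u).1 = delta_mx ord0 i by have [] := HP i.
pose E i := rho A (H i).
have Es i : smooth_pi_vfield A (E i) by exact: (rho_smooth mfd (Hs i)).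
have Gs i : smooth_vfield SA (gamma A (E i)) by exact: (gamma_smooth mfd (Es i)).
have etas := eta_smooth mfd.
pose Kf i := connection_map D (gamma A (E i)).
pose Hf i := connection_map D (H i).
have Kfs i : smooth_pi_vfield A (Kf i) by exact: (conn_smooth conn (Gs i) etas).
have Hfs i : smooth_pi_vfield A (Hf i) by exact: (conn_smooth conn (Hs i) etas).
have sE := frame_mx_smooth u Es.
have sK := frame_mx_smooth u Kfs.
have sH := frame_mx_smooth u Hfs.
have eu := at_dom (slit_proj u).
have invu : chart_inv (A := SA) (chart_at A (slit_proj u)) u (coord_at SA u) = u.
  exact: (slit_chart_invK mfd eu).
have Eu : frame_mx e E u \in unitmx by rewrite frame_mx_rho_id // unitmx1.
have Ku := vertical_frame_unitmx mfd conn reg eu Es Eu.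
have uE : in_chart_at SA u (frame_mx e E) (coord_at SA u) \in unitmx.
  exact: etrans (congr1 (fun w => frame_mx e E w \in unitmx) invu) Eu.
have uK : in_chart_at SA u (frame_mx e Kf) (coord_at SA u) \in unitmx.
  exact: etrans (congr1 (fun w => frame_mx e Kf w \in unitmx) invu) Ku.
have sxi := smooth_near_mulmx (Xs u) (smooth_near_invmx uE sE).
have sal := smooth_near_mulmx (smooth_near_mulmx sxi sH) (smooth_near_invmx uK sK).
have sHi := smooth_near_sum (index_enum 'I_n) (P := xpredT)
  (fun i _ => smooth_near_scale (smooth_near_coord ord0 i sxi) (Hs i u)).
have sGi := smooth_near_sum (index_enum 'I_n) (P := xpredT)
  (fun i _ => smooth_near_scale (smooth_near_coord ord0 i sal) (Gs i u)).
have S := smooth_near_add (smooth_near_scale (smooth_near_cst (-1 : R)) sGi) sHi.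
apply: smooth_near_eq S.
apply: filterS3 (near_coord_at mfd u) (near_unitmx sE uE) (near_unitmx sK uK).
move=> x [w ew [_ Ex]]; rewrite /in_chart_at /= Ex => Emu Kmu.
have B := beta_frame X Hs ew Emu Kmu.
apply: etrans (esym (congr1 (components (A := SA) e w) B)).
apply: etrans (esym (slit_components_linear mfd ew _ _ _)).
by congr (_ *: _ + _); apply: etrans (esym (slit_components_lincomb _ _ ew)).
Qed.

End Beta.

(** * The Finsler metric on a fibre *)

Section Slices.
Context {R : realType} {V V' W : normedModType R} (x0 : V).

(** The directional derivatives of the slice are slices of the derivatives along
    vectors of the second factor. *)
Lemma class_C_slice {k} {U : set (V * V')} {f : V * V' -> W} :
  class_C k U f -> class_C k [set y | U (x0, y)] (fun y => f (x0, y)).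
Proof.
elim: k f => [|k IH] f /=.
  move=> fc y Uy; apply: (@continuous_comp _ _ _ (fun y : V' => (x0, y)) f).
    by apply: cvg_pair; [exact: cvg_cst|exact: cvg_id].
  exact: fc.
move=> [df Df]; split=> [y Uy|v].
  apply: (@differentiable_comp _ _ _ _ (fun y : V' => (x0, y)) f); last exact: df.
  by apply: differentiable_pair; [exact: differentiable_cst|exact: ex_diff].
suff -> : 'D_v (fun y => f (x0, y)) = fun y => 'D_(0, v) f (x0, y) by exact: (IH _ (Df (0, v))).
apply/funext => y; apply: derive_line; near=> h.
by congr (f (_, _)); rewrite /= scaler0 add0r.
Unshelve. all: by end_near. Qed.

Lemma smooth_near_slice {y0 : V'} {f : V * V' -> W} :
  smooth_near (x0, y0) f -> smooth_near y0 (fun y => f (x0, y)).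
Proof.
move=> [U [oU Uy] fU]; exists [set y | U (x0, y)]; last by move=> k; exact: class_C_slice.
split => //; apply: (@open_comp _ _ (fun y : V' => (x0, y))) => // y _.
by apply: cvg_pair; [exact: cvg_cst|exact: cvg_id].
Qed.

End Slices.

Section FinslerMetric.
Context {R : realType} {n : nat} {M : topologicalType}.
Context {A : atlas 'rV[R]_n M} (mfd : is_smooth_manifold A).
Context {L : M * 'rV[R]_n -> R} (fin : is_finsler A L).
Local Notation Rn := 'rV[R]_n.
Local Notation SA := (slit_atlas A).
Local Notation slit := (slit R n M).
Local Notation g := (finsler_metric L).
Implicit Types (u w : slit).

(** In the chart selected at u, L restricted to the fibre through u is a slice of
    its coordinate expression. *)
Lemma fibre_energy_smooth u :
  smooth_near (eta u) (fun y : Rn => L (slit_proj u, y) ^+ 2).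
Proof.
have eu : chart_dom (chart_at A (slit_proj u)) (slit_proj u) := chart_at_dom mfd _.
have := finsler_smooth fin u; rewrite /smooth_at (coord_atE mfd) => /smooth_near_slice Ls.
apply: smooth_near_eq (smooth_near_mul Ls Ls).
apply: filterS (near_val_neq0 u) => y y0.
have -> : in_chart_at SA u (fun w => L (val w))
    (chart_map (chart_at A (slit_proj u)) (slit_proj u), y) = L (slit_proj u, y).
  pose r : slit := exist _ (slit_proj u, y) y0.
  have Er : chart_map (a := SA) (chart_at A (slit_proj u)) r
      = (chart_map (chart_at A (slit_proj u)) (slit_proj u), y).
    by rewrite /= (components_at mfd).
  rewrite -Er; exact: (congr1 (fun w => L (val w)) (slit_chart_invK mfd (w := r) eu)).
by rewrite expr2.
Qed.

(** The metric is a second directional derivative of a smooth function on the fibre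
    and is therefore bilinear. *)
Lemma metric_linearl u (w : Rn) : linear (fun v => g u v w).
Proof.
move=> a v v'; rewrite /finsler_metric.
have s := smooth_near_derive w (fibre_energy_smooth u).
rewrite (deriveDir a v v' (smooth_near_differentiable s)) mulrDr.
by congr (_ + _); exact: mulrCA.
Qed.

Lemma metric_linearr u (v : Rn) : linear (g u v).
Proof.
move=> a w w'; rewrite /finsler_metric.
have E := fibre_energy_smooth u.
have dw z := smooth_near_differentiable (smooth_near_derive z E).
rewrite (near_eq_derive v (g := (fun y => a *: 'D_w (fun y : Rn => L (slit_proj u, y) ^+ 2) y
   + 'D_w' (fun y : Rn => L (slit_proj u, y) ^+ 2) y))); last first.
  apply: filterS (smooth_near_near E) => y sy.
  exact: deriveDir (smooth_near_differentiable sy).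
have dZ := differentiableZ a (dw w).
rewrite (deriveD (diff_derivable dZ) (diff_derivable (dw w'))).
rewrite (deriveZ a (diff_derivable (dw w))) mulrDr.
by congr (_ + _); exact: mulrCA.
Qed.

Lemma metric_eq0 u v : g u v v = 0 -> v = 0.
Proof.
move=> g0; apply/eqP/negPn/negP => /(finsler_posdef fin u).
by rewrite g0 ltxx.
Qed.

Lemma metric0l u (w : Rn) : g u 0 w = 0.
Proof. exact: (linear0 (linear_of (metric_linearl u w))). Qed.

Lemma metric0r u v : g u v 0 = 0.
Proof. exact: (linear0 (linear_of (metric_linearr u v))). Qed.

End FinslerMetric.

(** * Forms of small rank and a product rule *)

Section LinearAlgebra.
Context {F : realFieldType} {n : nat}.

(** The forms are the columns of an n by m matrix of rank less than n, which has a
    nonzero left kernel. *)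
Lemma exists_common_zero {m} (phi : 'I_m -> 'rV[F]_n -> F) : (m < n)%N ->
  (forall j a v w, phi j (a *: v + w) = a * phi j v + phi j w) ->
  exists2 v, v != 0 & forall j, phi j v = 0.
Proof.
move=> mn lphi; pose C := \matrix_(i < n, j < m) phi j (delta_mx ord0 i).
have phi0 j : phi j 0 = 0.
  by have := lphi j (-1) 0 0; rewrite scaler0 addr0 mulN1r addNr.
have CE v j : (v *m C) ord0 j = phi j v.
  rewrite [in RHS](row_sum_delta v) mxE; elim: (index_enum _) => [|i r IH].
    by rewrite !big_nil phi0.
  by rewrite !big_cons IH lphi mxE.
have : kermx C != 0.
  rewrite -mxrank_eq0 mxrank_ker subn_eq0 -ltnNge.
  exact: leq_ltn_trans (rank_leq_col C) mn.
move=> /rowV0Pn[v /sub_kermxP vC v0]; exists v => // j.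
by rewrite -CE vC mxE.
Qed.

(** If h x z were nonzero, the relation would make h a product of two linear forms.
    In dimension three or more some nonzero y is killed by both l and h (., z);
    there h y y = g y y is nonzero, while the relation forces it to vanish. *)
Lemma angular_degenerate (g : 'rV[F]_n -> 'rV[F]_n -> F) (l : 'rV[F]_n -> F)
    (z : 'rV[F]_n) :
  let h v w := g v w - l v * l w in
  (3 <= n)%N ->
  (forall w a v v', g (a *: v + v') w = a * g v w + g v' w) ->
  (forall a v v', l (a *: v + v') = a * l v + l v') ->
  (forall v, g v v = 0 -> v = 0) ->
  (forall x y w, h x z * h y w = h x w * h y z) ->
  forall x, h x z = 0.
Proof.
move=> h n3 gl ll gdef rk x; apply/eqP/negPn/negP => hx.
have lh w a v v' : h (a *: v + v') w = a * h v w + h v' w.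
  by rewrite /h gl ll mulrBr mulrDl opprD addrACA mulrA.
pose phi (j : 'I_2) v := if j == ord0 then l v else h v z.
have lphi j a v w : phi j (a *: v + w) = a * phi j v + phi j w.
  by rewrite /phi; case: ifP.
have [y y0 yphi] := exists_common_zero n3 lphi.
have ly : l y = 0 := yphi ord0.
have hy : h y z = 0 := yphi ord_max.
have := rk x y y; rewrite hy mulr0 => /eqP; rewrite mulf_eq0 (negPf hx) /=.
by rewrite /h ly mul0r subr0 => /eqP /gdef /eqP; rewrite (negPf y0).
Qed.

End LinearAlgebra.

(** Since F vanishes at x, the difference quotient of the product is that of F
    times a factor tending to f x.  As f x is nonzero, both quotients converge or
    both diverge, and in the second case both derivatives have the value 0 by
    convention. *)
Lemma derive_scale_vanishing {R : realType} {V : normedModType R} {f F : V -> R}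
    {x v : V} : {for x, continuous f} -> f x != 0 -> F x = 0 ->
  'D_v (fun y => f y * F y) x = f x * 'D_v F x.
Proof.
move=> fc fx0 Fx; rewrite /derive.
set q := fun h : R => h^-1 *: ((F \o shift x) (h *: v) - F x).
set q' := fun h : R => h^-1 *: _.
have fl : (fun h : R => f (h *: v + x)) @ 0^' --> f x.
  by apply: cvg_within_filter; exact: (cvg_comp _ f (@cvg_line _ _ v x) fc).
have q'E : q' = (fun h => f (h *: v + x) * q h).
  by apply/funext => h; rewrite /q' /q /= Fx mulr0 !subr0 scalerAr.
have [/cvg_ex[l ql]|Nq] := pselect (cvg (q @ 0^')).
  rewrite (cvg_lim _ ql) //; apply: cvg_lim => //; rewrite q'E; exact: cvgM.
have Nq' : ~ cvg (q' @ 0^').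
  move=> /cvg_ex[l ql]; apply: Nq; apply/cvg_ex; exists ((f x)^-1 * l).
  have lim_q : (fun h => (f (h *: v + x))^-1 * q' h) @ 0^' --> (f x)^-1 * l.
    exact: cvgM (cvgV fx0 fl) ql.
  have : \forall h \near 0^', f (h *: v + x) != 0 by exact: (cvgr_neq0 _ fl fx0).
  move=> fn0; have E : \forall h \near 0^', (f (h *: v + x))^-1 * q' h = q h.
    by apply: filterS fn0 => h fh; rewrite q'E mulKf.
  exact: cvg_trans (near_eq_cvg E) lim_q.
by rewrite (dvgP Nq) (dvgP Nq') mulr0.
Qed.

(** * Concurrent fields *)

Section Concurrent.
Context {R : realType} {n : nat} {M : topologicalType}.
Context {A : atlas 'rV[R]_n M} (mfd : is_smooth_manifold A).
Context {L : M * 'rV[R]_n -> R} (fin : is_finsler A L).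
Local Notation Rn := 'rV[R]_n.
Local Notation SA := (slit_atlas A).
Local Notation slit := (slit R n M).
Local Notation g := (finsler_metric L).
Local Notation vfield := (slit -> Rn * Rn).
Local Notation pi_vfield := (slit -> Rn).
Implicit Types (u : slit).
Context {nabla : vfield -> pi_vfield -> pi_vfield}.
Context (cartan : is_cartan_connection A L nabla).

Let conn : is_connection A nabla := cartan_connection cartan.
Let reg : regular A nabla := cartan_regular cartan.
Let etas : smooth_pi_vfield A (@eta R n M) := eta_smooth mfd.
Let slit_inv (w : slit) : Rn * Rn -> slit := chart_inv (A := SA) (chart_at A (slit_proj w)) w.

Lemma slit_inv_coord w : slit_inv w (coord_at SA w) = w.
Proof. exact: (slit_chart_invK mfd (chart_at_dom mfd (slit_proj w))). Qed.

(** The last term of the curvature is a derivative along the bracket, which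
    enters here as a smooth vertical field. *)
Lemma v_curvature_smooth (X Y Z : pi_vfield) : smooth_pi_vfield A X ->
  smooth_pi_vfield A Y -> smooth_pi_vfield A Z ->
  smooth_pi_vfield A (v_curvature A nabla X Y Z).
Proof.
move=> Xs Ys Zs; have gX := gamma_smooth mfd Xs; have gY := gamma_smooth mfd Ys.
have bs : smooth_vfield SA (lie_bracket SA (gamma A X) (gamma A Y)).
  have fs := gamma_smooth mfd (fibre_bracket_smooth mfd Xs Ys).
  by rewrite (lie_bracket_gamma mfd Xs Ys).
have s1 := conn_smooth conn gX (conn_smooth conn gY Zs).
have s2 := conn_smooth conn gY (conn_smooth conn gX Zs).
have s3 := conn_smooth conn bs Zs.
have := pi_vfield_lin_smooth mfd 1 (pi_vfield_lin_smooth mfd (-1) s1 s2) s3.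
by congr smooth_pi_vfield; apply/funext => w; rewrite scale1r scaleN1r.
Qed.

(** The connection map sends the vertical space at w isomorphically to the tangent
    space, because it is injective there. *)
Lemma vertical_derivative_eta_surj (w : slit) (y : Rn) : exists X : pi_vfield,
  smooth_pi_vfield A X /\ nabla (gamma A X) (@eta R n M) w = y.
Proof.
have ew := chart_at_dom mfd (slit_proj w).
have [E EP] := choice (fun i : 'I_n => exists_pi_vfield_through mfd reg w (delta_mx ord0 i)).
have Es i : smooth_pi_vfield A (E i) by have [] := EP i.
have Eu : frame_mx (chart_at A (slit_proj w)) E w \in unitmx.
  rewrite [frame_mx _ _ _](_ : _ = 1%:M) ?unitmx1 //; apply/matrixP => i j.
  by rewrite mxE (components_at mfd) (EP i).2 !mxE eqxx eq_sym.
have Ku := vertical_frame_unitmx mfd conn reg ew Es Eu.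
set K := (X in X \in _) in Ku; pose a := y *m invmx K.
exists (lincomb a E); split; first exact: lincomb_pi_vfield_smooth.
have aK : a *m K = y by exact: mulmxKV.
rewrite (gamma_lincomb mfd) -[RHS]aK.
apply: etrans (conn_lincomb mfd conn a w (fun i => gamma_smooth mfd (Es i)) etas) _.
apply: etrans (esym (mul_frame_mx mfd _ a ew)).
by rewrite (components_at mfd).
Qed.

Lemma near_neq0 (S : pi_vfield) u : smooth_pi_vfield A S -> S u != 0 ->
  \forall x \near coord_at SA u, S (slit_inv u x) != 0.
Proof.
move=> Ss Su; have Sc := differentiable_continuous (smooth_near_differentiable (Ss u)).
have S0 : in_chart_at SA u
    (fun w => components (chart_at A (slit_proj u)) (slit_proj w) (S w)) (coord_at SA u) != 0.
  by move: Su; rewrite /in_chart_at /= [chart_inv _ _ _]slit_inv_coord (components_at mfd).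
have : \forall x \near coord_at SA u, in_chart_at SA u
    (fun w => components (chart_at A (slit_proj u)) (slit_proj w) (S w)) x != 0.
  exact: (cvgr_neq0 _ Sc S0).
apply: filterS => x; apply: contra_neq => Sx.
by rewrite /in_chart_at /= [S _]Sx /components /tderive derive0.
Qed.

Context {zeta : pi_vfield} (conc : is_concurrent A nabla zeta).
Let zetas : smooth_pi_vfield A zeta := conc.1.

(** Each of the three terms of the curvature differentiates zeta vertically. *)
Lemma concurrent_v_curvature (X Y : pi_vfield) u : smooth_pi_vfield A X ->
  smooth_pi_vfield A Y -> v_curvature A nabla X Y zeta u = 0.
Proof.
move=> Xs Ys; rewrite /v_curvature /curvature.
have gX := gamma_smooth mfd Xs; have gY := gamma_smooth mfd Ys.
have zX : nabla (gamma A X) zeta = fun=> 0.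
  by apply/funext => w; exact: (conc.2 X Xs w).2.
have zY : nabla (gamma A Y) zeta = fun=> 0.
  by apply/funext => w; exact: (conc.2 Y Ys w).2.
have E1 : nabla (gamma A X) (nabla (gamma A Y) zeta) u = 0.
  exact: etrans (congr1 (fun F => nabla (gamma A X) F u) zY) (conn0r mfd conn u gX).
have E2 : nabla (gamma A Y) (nabla (gamma A X) zeta) u = 0.
  exact: etrans (congr1 (fun F => nabla (gamma A Y) F u) zX) (conn0r mfd conn u gY).
have E3 : nabla (lie_bracket SA (gamma A X) (gamma A Y)) zeta u = 0.
  apply: etrans (congr1 (fun V => nabla V zeta u) (lie_bracket_gamma mfd Xs Ys)) _.
  exact: (conc.2 _ (fibre_bracket_smooth mfd Xs Ys) u).2.
apply: etrans (congr2 +%R (congr2 (fun a b => - a + b) E1 E2) E3) _.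
by rewrite oppr0 !addr0.
Qed.

Lemma concurrent_parallel_eta (X Y Z : pi_vfield) u : is_S3_like A L nabla ->
  smooth_pi_vfield A X -> smooth_pi_vfield A Y -> smooth_pi_vfield A Z ->
  v_curvature A nabla X Y Z u != 0 -> exists a, zeta u = a *: eta u.
Proof.
move=> [n4 S3] Xs Ys Zs S0.
have Ss := v_curvature_smooth Xs Ys Zs.
set k := v_scalar A L nabla u / ((n%:R - 1) * (n%:R - 2)).
have k0 : k != 0.
  apply/eqP => k0; move/eqP: S0; apply; apply: (metric_eq0 fin (u := u)).
  by rewrite (S3 _ _ _ _ Xs Ys Zs Ss u) -/k k0 mul0r.
have gl w a v v' : g u (a *: v + v') w = a * g u v w + g u v' w.
  exact: (metric_linearl mfd fin u w a v v').
have gr w a v v' : g u w (a *: v + v') = a * g u w v + g u w v'.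
  exact: (metric_linearr mfd fin u w a v v').
have ll a v v' : ell L u (a *: v + v') = a * ell L u v + ell L u v'.
  by rewrite /ell gl mulrDr mulrCA.
have hz : forall x, g u x (zeta u) - ell L u x * ell L u (zeta u) = 0.
  apply: (angular_degenerate (ltnW n4) gl ll (@metric_eq0 _ _ _ _ _ fin u)) => x y w.
  have [X' [X's XE]] := exists_pi_vfield_through mfd reg u x.
  have [Y' [Y's YE]] := exists_pi_vfield_through mfd reg u y.
  have [W' [W's WE]] := exists_pi_vfield_through mfd reg u w.
  have S3u := S3 _ _ _ _ X's Y's zetas W's u.
  have c0 := congr1 (fun z => g u z (W' u)) (concurrent_v_curvature u X's Y's).
  have := etrans (esym S3u) (etrans c0 (metric0l mfd fin u _)).
  rewrite XE YE WE -/k => /eqP.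
  by rewrite mulf_eq0 (negPf k0) subr_eq0 => /eqP.
(* hbar (., zeta) = 0 reads g (., zeta) = ell (zeta) L^-1 g (., eta). *)
pose a := (L (val u))^-1 * ell L u (zeta u).
exists a; apply/eqP; rewrite -subr_eq0 addrC -scaleNr; apply/eqP.
apply: (metric_eq0 fin (u := u)); set d := _ + _.
have hzd : g u d (zeta u) = ell L u d * ell L u (zeta u) by apply/eqP; rewrite -subr_eq0 hz.
by rewrite {2}/d gr hzd /a [ell L u d]/ell mulNr mulrAC addNr.
Qed.

(** Vertical derivatives of zeta vanish whereas those of eta fill the tangent space,
    so zeta can only be a multiple of eta on an open set if the factor is 0. *)
Lemma concurrent_vanishes u : (1 < n)%N ->
  (\forall x \near coord_at SA u,
     exists a, zeta (slit_inv u x) = a *: eta (slit_inv u x)) -> zeta u = 0.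
Proof.
move=> n1 par; set c := chart_at A (slit_proj u).
have [i etai] : exists i, (eta u) ord0 i != 0 by exact/rV0Pn/(valP u).
have co := coord_atE mfd u.
pose yi (x : Rn * Rn) : R := x.2 ord0 i.
(* The factor is the quotient of the i-th coordinates; written this way it is
   visibly continuous. *)
pose f (x : Rn * Rn) := in_chart_at SA u
  (fun w => components c (slit_proj w) (zeta w)) x ord0 i * (yi x)^-1.
have lc : linear (fun p : Rn * Rn => p.2) by [].
have cc : continuous (linear_of lc) by move=> p; exact: cvg_snd.
have s2 : smooth_near (coord_at SA u) yi.
  exact: (smooth_near_coord ord0 i (smooth_near_lin (x := coord_at SA u) cc)).
have c2 : yi (coord_at SA u) != 0 by rewrite /yi co.
have fs : smooth_near (coord_at SA u) f.
  exact: smooth_near_mul (smooth_near_coord ord0 i (zetas u)) (smooth_near_inv c2 s2).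
have fc := differentiable_continuous (smooth_near_differentiable fs).
have n2 : \forall x \near coord_at SA u, yi x != 0.
  have s2c : {for coord_at SA u, continuous yi}.
    exact: differentiable_continuous (smooth_near_differentiable s2).
  exact: (cvgr_neq0 _ s2c c2).
have zf : \forall x \near coord_at SA u, zeta (slit_inv u x) = f x *: eta (slit_inv u x).
  apply: filterS3 (near_coord_at mfd u) n2 par => x [w ew [xE Ew]] x0 [a].
  rewrite /f /in_chart_at /= /slit_inv Ew => za; rewrite za; congr (_ *: _).
  have cl : components c (slit_proj w) (a *: eta w) = a *: components c (slit_proj w) (eta w).
    exact: (linear_fZ (components_linear mfd ew)).
  have yx : components c (slit_proj w) (eta w) ord0 i = yi x by rewrite /yi xE.
  by rewrite cl mxE yx (mulfK x0).
have zu : zeta u = f (coord_at SA u) *: eta u.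
  by have := nbhs_singleton zf; rewrite slit_inv_coord.
have [f0|f0] := eqVneq (f (coord_at SA u)) 0; first by rewrite zu f0 scale0r.
(* A nonzero y orthogonal to eta: then g(Y, eta) vanishes at u, which removes
   the derivative of f from the product rule. *)
have [y y0 yeta] := exists_common_zero (phi := fun _ : 'I_1 => (fun y => g u y (eta u)))
  n1 (fun j a v w => metric_linearl mfd fin u (eta u) a v w).
have {}yeta : g u y (eta u) = 0 := yeta ord0.
have [X [Xs XE]] := vertical_derivative_eta_surj u y.
have [Y [Ys YE]] := exists_pi_vfield_through mfd reg u y.
have gX := gamma_smooth mfd Xs.
have mz := cartan_metric cartan gX Ys zetas u.
have me := cartan_metric cartan gX Ys etas u.
have gr w a v : g u w (a *: v) = a * g u w v.
  exact: (linear_fZ (metric_linearr mfd fin u w)).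
have E : tderive SA (fun w => g w (Y w) (zeta w)) u (gamma A X u)
    = f (coord_at SA u) * tderive SA (fun w => g w (Y w) (eta w)) u (gamma A X u).
  have G0 : in_chart_at SA u (fun w => g w (Y w) (eta w)) (coord_at SA u) = 0.
    by rewrite /in_chart_at /= [chart_inv _ _ _]slit_inv_coord YE.
  rewrite /tderive -(derive_scale_vanishing fc f0 G0).
  apply: near_eq_derive; apply: filterS zf => x zx.
  rewrite /in_chart_at /= [zeta _]zx.
  exact: (linear_fZ (metric_linearr mfd fin _ _)).
set gD := g u (nabla (gamma A X) Y u) (eta u) in me.
have z1 : g u (Y u) (nabla (gamma A X) zeta u) = 0.
  exact (etrans (congr1 (g u (Y u)) (conc.2 X Xs u).2) (metric0r mfd fin u (Y u))).
have z2 : g u (nabla (gamma A X) Y u) (zeta u) = f (coord_at SA u) * gD.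
  exact (etrans (congr1 (g u (nabla (gamma A X) Y u)) zu) (gr _ _ _)).
have e1 : g u (Y u) (nabla (gamma A X) (@eta R n M) u) = g u y y.
  exact (congr2 (g u) YE XE).
have H := etrans (esym mz) (etrans E (congr1 (fun z => _ * z) me)).
have := etrans (esym (congr2 +%R z2 z1)) (etrans H (congr1 (fun z => _ * (gD + z)) e1)).
move: gD {me z1 z2 e1 H mz E} => gD /eqP.
rewrite addr0 mulrDr eq_sym -subr_eq0 addrAC subrr add0r mulf_eq0 (negPf f0) /=.
by move=> /eqP /(metric_eq0 fin) /eqP; rewrite (negPf y0).
Qed.

(** A concurrent field has the nonzero derivative - eta along beta eta. *)
Lemma concurrent_not_near0 u :
  ~ (\forall x \near coord_at SA u, zeta (slit_inv u x) = 0).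
Proof.
move=> z0; have bs := beta_smooth mfd conn reg etas.
have := cartan_metric cartan bs etas zetas u.
rewrite (conc.2 _ etas u).1.
have zu : zeta u = 0 by have := nbhs_singleton z0; rewrite slit_inv_coord.
rewrite zu (metric0r mfd fin) add0r -scaleN1r.
have -> : g u (eta u) (-1 *: eta u) = -1 * g u (eta u) (eta u).
  exact: (linear_fZ (metric_linearr mfd fin u _)).
have -> : tderive SA (fun w => g w (eta w) (zeta w)) u (beta A nabla (@eta R n M) u) = 0.
  rewrite /tderive -[RHS](derive_cst (0 : R) (coord_at SA u) (beta A nabla (@eta R n M) u)).
  apply: near_eq_derive; apply: filterS z0 => x zx.
  by rewrite /in_chart_at /= [zeta _]zx (metric0r mfd fin).
rewrite mulN1r => /esym/eqP; rewrite oppr_eq0 => /eqP /(metric_eq0 fin) /eqP.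
by apply/negP; exact: (valP u).
Qed.

End Concurrent.

Unset Implicit Arguments.
Set Strict Implicit.
Set Printing Implicit Defensive.

Theorem theorem3p13 (R : realType) (n : nat) (M : topologicalType)
    (A : atlas 'rV[R]_n M) (L : M * 'rV[R]_n -> R)
    (nabla : (slit R n M -> 'rV[R]_n * 'rV[R]_n) ->
             (slit R n M -> 'rV[R]_n) -> (slit R n M -> 'rV[R]_n))
    (zeta : slit R n M -> 'rV[R]_n) :
  (4 <= n)%N ->
  is_smooth_manifold A ->
  is_finsler A L ->
  is_cartan_connection A L nabla ->
  is_S3_like A L nabla ->
  is_concurrent A nabla zeta ->
  forall X Y Z : slit R n M -> 'rV[R]_n,
    smooth_pi_vfield A X -> smooth_pi_vfield A Y -> smooth_pi_vfield A Z ->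
    forall u : slit R n M, v_curvature A nabla X Y Z u = 0.
Proof.
move=> n4 mfd fin cartan S3 conc X Y Z Xs Ys Zs u.
have Ss := v_curvature_smooth mfd cartan Xs Ys Zs.
apply/eqP/negPn/negP => Su; apply: (concurrent_not_near0 mfd fin cartan conc (u := u)).
apply: filterS (near_neq0 mfd Ss Su) => x Sx.
apply: (concurrent_vanishes mfd fin cartan conc (ltnW (ltnW n4))).
apply: filterS (near_neq0 mfd Ss Sx) => y Sy.
exact: (concurrent_parallel_eta mfd fin cartan conc S3 Xs Ys Zs Sy).
Qed.
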